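(* Let $\mathsf A$ be a unital $C^*$-algebra, $\mathsf S$ a $*$-semigroup and $\omega\colon\mathsf S\to\mathsf A$ an $\mathsf A$-positive definite function. 1. There are an $\mathsf A$-positive definite extension $\omega^+\colon\mathsf S^+\to\mathsf A$ of $\omega$, for which the operators $\varPhi_{\omega^+}(\mathsf s)$, $\mathsf s\in\mathsf S$, are well defined in $\mathbf B^*(\mathcal E_{\omega^+})$, and an operator $V^+\in\mathbf B^*(\mathsf A,\mathcal E_{\omega^+})$ such that $$\mathsf a^*\omega(\mathsf s)\mathsf b=\langle V^+\mathsf a,\varPhi_{\omega^+}(\mathsf s)V^+\mathsf b\rangle_{\omega^+},\qquad \mathsf s\in\mathsf S,\ \mathsf a,\mathsf b\in\mathsf A,$$ if and only if $\omega$ satisfies the boundedness condition and has the extension property. 2. Suppose $\omega$ satisfies the boundedness condition and $$(\boldsymbol{\ast})\qquad\omega\in\mathcal E_\omega\quad\text{and}\quad\omega(\mathsf s^* )=\omega(\mathsf s)^*,\ \ \mathsf s\in\mathsf S .$$ Then there is $V\in\mathbf B^*(\mathsf A,\mathcal E_\omega)$ such that $$\mathsf a^*\omega(\mathsf s)\mathsf b=\langle V\mathsf a,\varPhi_\omega(\mathsf s)V\mathsf b\rangle_\omega,\qquad \mathsf s\in\mathsf S,\ \mathsf a,\mathsf b\in\mathsf A.$$ The operator $V$ is given by $V\mathsf a=\omega\mathsf a$, $\mathsf a\in\mathsf A$, and its adjoint by $V^*(\omega_{\mathsf s}\mathsf a)=\omega(\mathsf s)\mathsf a$. Therefore $$\mathsf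 a^*\omega(\mathsf s)\mathsf b=\langle\omega\mathsf a,\varPhi_\omega(\mathsf s)\,\omega\mathsf b\rangle_\omega,\qquad \mathsf s\in\mathsf S,\ \mathsf a,\mathsf b\in\mathsf A.$$ 3. Under the assumptions of part 2, the triple $(\mathcal E_\omega,\varPhi_\omega,V)$ with the $V$ of part 2 is minimal, i.e. $\mathcal E_\omega$ is the closed linear span of $\{\varPhi_\omega(\mathsf s)V\mathsf a:\mathsf s\in\mathsf S,\ \mathsf a\in\mathsf A\}$. Consequently, $$\omega(\mathsf s)=V^*\varPhi_\omega(\mathsf s)V,\qquad\mathsf s\in\mathsf S.$$
   Context: Hilbert $\mathsf A$-modules are right modules with inner product linear in the second variable, $\langle\xi,\eta\mathsf a\rangle=\langle\xi,\eta\rangle\mathsf a$, $\langle\eta,\xi\rangle=\langle\xi,\eta\rangle^*$, norm $\|\xi\|=\|\langle\xi,\xi\rangle\|^{1/2}$. $\mathbf B^*(\varXi,\varXi_1)$ is the set of adjointable operators, $\mathbf B^*(\varXi)=\mathbf B^*(\varXi,\varXi)$. $\mathsf A$ is a Hilbert $\mathsf A$-module with $\langle a,b\rangle_{\mathsf A}=a^*b$, and elements of $\mathsf A$ are identified with left multiplications in $\mathbf B^*(\mathsf A)$. A $*$-semigroup is a semigroup with an involution satisfying $(\mathsf s\mathsf t)^*=\mathsf t^*\mathsf s^*$, $\mathsf s^{**}=\mathsf s$. $\mathsf S^+=\mathsf S\cup\{\mathsf 1\}$ is its unitization ($\mathsf 1\mathsf s=\mathsf s\mathsf 1=\mathsf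 s$, $\mathsf 1^*=\mathsf 1$) if $\mathsf S$ has no unit, and $\mathsf S^+=\mathsf S$ otherwise. $\omega$ is $\mathsf A$-positive definite if $\sum_{k,l}\mathsf a_k^*\omega(\mathsf s_k^*\mathsf s_l)\mathsf a_l\geqslant0$ for all finite families of $\mathsf s_n$ in the semigroup and $\mathsf a_n\in\mathsf A$. Extension property: $\omega$ extends to an $\mathsf A$-positive definite function on $\mathsf S^+$; equivalently, $\omega(\mathsf s^* )=\omega(\mathsf s)^*$ for all $\mathsf s$ and, for some $c>0$, $c\sum_{i,j}\mathsf a_i^*\omega(\mathsf s_i)^*\omega(\mathsf s_j)\mathsf a_j\leqslant\sum_{i,j}\mathsf a_i^*\omega(\mathsf s_i^*\mathsf s_j)\mathsf a_j$ for all finite families. Boundedness condition: for every $\mathsf s\in\mathsf S$ there is $c(\mathsf s)\geqslant0$ with $\|\sum_{i,j}\mathsf a_i^*\omega(\mathsf s_i^*\mathsf s^*\mathsf s\,\mathsf s_j)\mathsf a_j\|_{\mathsf A}\leqslant c(\mathsf s)\|\sum_{i,j}\mathsf a_i^*\omega(\mathsf s_i^*\mathsf s_j)\mathsf a_j\|_{\mathsf A}$ for all finite families $(\mathsf s_m)\subset\mathsf S$, $(\mathsf a_m)\subset\mathsf A$; equivalently, there are a submultiplicative $c\colon\mathsf S\to[0,\infty)$ and $d\colon\mathsf S\times\mathsf A\to[0,\infty)$ with $\|\mathsf a^*\omega(\mathsf t^*\mathsf s^*\mathsf s\mathsf t)\mathsf a\|_{\mathsf A}\leqslant d(\mathsf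 t,\mathsf a)c(\mathsf s)$. $\mathcal E_\omega$ is the reproducing kernel Hilbert $\mathsf A$-module of the kernel $(\mathsf s,\mathsf t)\mapsto\omega(\mathsf s^*\mathsf t)$: a Hilbert $\mathsf A$-module of $\mathsf A$-valued functions on $\mathsf S$ containing $\omega_{\mathsf s}=\omega(\mathsf s^*\,\cdot\,)$, in which the linear span $\mathcal D_\omega$ of all $\omega_{\mathsf s}\mathsf a$ ($\mathsf s\in\mathsf S$, $\mathsf a\in\mathsf A$) is dense, with $\langle\omega_{\mathsf t}\mathsf b,\omega_{\mathsf s}\mathsf a\rangle_\omega=\mathsf b^*\omega(\mathsf t^*\mathsf s)\mathsf a$ and $F(\mathsf s)=\langle F,\omega_{\mathsf s}\rangle_\omega$ for $F\in\mathcal E_\omega$. The module operations on these functions are those transported from the completion of $\mathcal D_\omega$ by the last identity: $(F\mathsf a)(\mathsf s)=\mathsf a^*F(\mathsf s)$, $(\lambda F)(\mathsf s)=\bar\lambda F(\mathsf s)$; $\omega\mathsf a$ and $\omega_{\mathsf s}\mathsf a$ denote such module products. $\varPhi_\omega(\mathsf s)$ is the operator $\sum_i\omega_{\mathsf s_i}\mathsf a_i\mapsto\sum_i\omega_{\mathsf s\mathsf s_i}\mathsf a_i$ on $\mathcal D_\omega$; under the boundedness condition it is well defined and extends to an element of $\mathbf B^*(\mathcal E_\omega)$, denoted by the same symbol, and $\varPhi_\omega$ is a $*$-homomorphism. $\mathcal E_{\omega^+}$ and $\varPhi_{\omega^+}$ are the same objects for $\omega^+$ on $\mathsf S^+$.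 *)

(* Defs.v *)
(* The scalars are R[i] with R : realType. In R[i], 0 <= c means that c is a  *)
(* nonnegative real, and norms of normed modules over R[i] are such elements. *)
From HB Require Import structures.
From mathcomp Require Import all_boot all_order all_algebra.
From mathcomp Require Import all_classical all_reals all_analysis.
From mathcomp Require Import complex.
Set Implicit Arguments.
Unset Strict Implicit.
Unset Printing Implicit Defensive.
Import Order.TTheory GRing.Theory Num.Theory.
Import numFieldNormedType.Exports.

Local Open Scope classical_set_scope.
Local Open Scope complex_scope.
Local Open Scope ring_scope.

Reserved Notation "x ^†" (at level 1, format "x ^†").
Reserved Notation "x ◁ a" (at level 40, left associativity).

(* HB rejects a direct join of CompleteNormedModule with a ring structure,    *)
(* because NumDomain already joins a norm and a ring and comes earlier in the *)
(* hierarchy; hence the ring axioms are part of the mixin and the pzRingType  *)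
(* instance is derived from them. The zero algebra is not excluded.           *)
HB.mixin Record isCStarAlgebra (R : realType) A
    of CompleteNormedModule R[i] A := {
  cmul : A -> A -> A ;
  cone : A ;
  cmulA : associative cmul ;
  cmul1l : left_id cone cmul ;
  cmul1r : right_id cone cmul ;
  cmulDl : left_distributive cmul +%R ;
  cmulDr : right_distributive cmul +%R ;
  cmulZl : forall (l : R[i]) (a b : A), cmul (l *: a) b = l *: cmul a b ;
  cmulZr : forall (l : R[i]) (a b : A), cmul a (l *: b) = l *: cmul a b ;
  cstar : A -> A ;
  cstarD : forall a b, cstar (a + b) = cstar a + cstar b ;
  cstarZ : forall (l : R[i]) (a : A), cstar (l *: a) = l^*%C *: cstar a ;
  cstarM : forall a b, cstar (cmul a b) = cmul (cstar b) (cstar a) ;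
  cstarK : involutive cstar ;
  normcM : forall a b : A, `|cmul a b| <= `|a| * `|b| ;
  normc_cstar : forall a : A, `|cmul (cstar a) a| = `|a| ^+ 2
}.

#[short(type="cstarType")]
HB.structure Definition CStarAlgebra (R : realType) :=
  {A of CompleteNormedModule R[i] A & isCStarAlgebra R A}.

Section CStarRing.
Context (R : realType) (A : cstarType R).

HB.instance Definition _ :=
  GRing.Zmodule_isPzRing.Build A cmulA cmul1l cmul1r cmulDl cmulDr.

End CStarRing.

Notation "a ^†" := (cstar a) : ring_scope.

Definition positive (R : realType) (A : cstarType R) (a : A) : Prop :=
  exists b : A, a = b^† * b.

(* normE makes the inner product definite; inner is linear in its second      *)
(* variable, hence conjugate-linear in the first one.                         *)
HB.mixin Record isHilbertModule (R : realType) (A : cstarType R) E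
    of CompleteNormedModule R[i] E := {
  act : E -> A -> E ;
  inner : E -> E -> A ;
  actDl : forall x y a, act (x + y) a = act x a + act y a ;
  actDr : forall x a b, act x (a + b) = act x a + act x b ;
  actM : forall x a b, act x (a * b) = act (act x a) b ;
  act1 : forall x, act x 1 = x ;
  actZl : forall (l : R[i]) (x : E) a, act (l *: x) a = l *: act x a ;
  actZr : forall (l : R[i]) x (a : A), act x (l *: a) = l *: act x a ;
  innerDr : forall x y z, inner x (y + z) = inner x y + inner x z ;
  innerZr : forall (l : R[i]) x (y : E), inner x (l *: y) = l *: inner x y ;
  inner_act : forall x y a, inner x (act y a) = inner x y * a ;
  inner_star : forall y x, (inner x y)^† = inner y x ;
  inner_ge0 : forall x, positive (inner x x) ;
  normE : forall x : E, `|x| = sqrtC `|inner x x|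
}.

#[short(type="hilbertModType")]
HB.structure Definition HilbertModule (R : realType) (A : cstarType R) :=
  {E of CompleteNormedModule R[i] E & isHilbertModule R A E}.

Notation "x ◁ a" := (act x a) : ring_scope.


(* A itself, with x ◁ a = x * a and <x, y> = x^† * y; an alias is used so that *)
(* the instance is keyed on a constant.                                       *)
Definition regular_module (R : realType) (A : cstarType R) : Type := A.

Section RegularModule.
Context (R : realType) (A : cstarType R).

HB.instance Definition _ := CompleteNormedModule.on (regular_module A).

Let mulZr (l : R[i]) (x a : A) : x * (l *: a) = l *: (x * a).
Proof. exact: cmulZr. Qed.

Let mulZl (l : R[i]) (x a : A) : (l *: x) * a = l *: (x * a).
Proof. exact: cmulZl. Qed.

Let inner_mul (x y a : A) : x^† * (y * a) = x^† * y * a.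
Proof. exact: mulrA. Qed.

Let inner_adj (y x : A) : (x^† * y)^† = y^† * x.
Proof. by rewrite [LHS]cstarM cstarK. Qed.

Let inner_pos (x : A) : positive (x^† * x).
Proof. by exists x. Qed.

Let norm_inner (x : A) : `|x| = sqrtC `|x^† * x|.
Proof. by rewrite [in RHS](normc_cstar x) sqrCK. Qed.

HB.instance Definition _ := @isHilbertModule.Build R A (regular_module A)
  (fun x a : A => x * a) (fun x y : A => x^† * y)
  (@mulrDl A) (@mulrDr A) (@mulrA A) (@mulr1 A) mulZl mulZr
  (fun x y z : A => mulrDr x^† y z) (fun l x y => mulZr l x^† y)
  inner_mul inner_adj inner_pos norm_inner.

End RegularModule.

(* Linearity and boundedness follow from the existence of the adjoint.        *)
Record adjointable (R : realType) (A : cstarType R) (E F : hilbertModType A) :=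
  Adjointable {
    adj_fun :> E -> F ;
    adjoint : F -> E ;
    adjointP : forall x y, inner (adj_fun x) y = inner x (adjoint y)
  }.

(* B*(E, F), and the elements of A as left multiplications in B*(A).          *)
Notation "''B*' ( E , F )" := (adjointable E F)
  (at level 8, format "''B*' ( E ,  F )") : type_scope.

Section LeftMultiplication.
Context (R : realType) (A : cstarType R).

Let lmulP (a : A) (x y : regular_module A) :
  inner ((a * x : A) : regular_module A) y =
  inner x ((a^† * y : A) : regular_module A).
Proof. by rewrite /inner /= [(a * x)^†]cstarM -mulrA. Qed.

Definition lmul (a : A) : 'B*(regular_module A, regular_module A) :=
  Adjointable (lmulP a).

End LeftMultiplication.

Definition lin_span (K : numFieldType) (E : normedModType K) (X : set E) :
    set E :=
  [set x | exists n (c : 'I_n -> K) (v : 'I_n -> E),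
     (forall i, X (v i)) /\ x = \sum_i c i *: v i].

(* Unlike starMonoidType, no unit is required. The choice structure carried   *)
(* by semigroupType is no restriction in presence of the classical axioms.    *)
HB.mixin Record isStarSemigroup S of Semigroup S := {
  sstar : S -> S ;
  sstarM : forall s t, sstar (s * t)%g = (sstar t * sstar s)%g ;
  sstarK : involutive sstar
}.

#[short(type="starSemigroupType")]
HB.structure Definition StarSemigroup := {S of Semigroup S & isStarSemigroup S}.

Notation "s ^†" := (sstar s) : group_scope.

Definition is_unit (S : magmaType) (e : S) : Prop :=
  forall s, (e * s = s)%g /\ (s * e = s)%g.

(* S^+: a unit is adjoined only when S has none, and then only one because of *)
(* proof irrelevance; base_elt is a bijection if S has a unit.                *)
Inductive unitization (S : magmaType) : Type :=
| base_elt of S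
| adj_unit of ~ exists e : S, is_unit e.

Section Unitization.
Context (S : starSemigroupType).

Definition unitization_mul (x y : unitization S) : unitization S :=
  match x, y with
  | base_elt s, base_elt t => base_elt (s * t)%g
  | base_elt s, adj_unit _ => base_elt s
  | adj_unit _, y => y
  end.

Definition unitization_star (x : unitization S) : unitization S :=
  match x with
  | base_elt s => base_elt (s^†)%g
  | adj_unit h => adj_unit h
  end.

HB.instance Definition _ := gen_eqMixin (unitization S).
HB.instance Definition _ := gen_choiceMixin (unitization S).

Let mulA : associative unitization_mul.
Proof. by move=> [s|h] [t|h'] [u|h''] //=; rewrite mulgA. Qed.

HB.instance Definition _ := isSemigroup.Build (unitization S) mulA.

Let starM (x y : unitization S) :
  unitization_star (x * y)%g = (unitization_star y * unitization_star x)%g.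
Proof.
case: x y => [s|h] [t|h'] //; first by congr base_elt; exact: sstarM.
by congr adj_unit; exact: Prop_irrelevance.
Qed.

Let starK : involutive unitization_star.
Proof. by case=> [s|h] //=; rewrite sstarK. Qed.

HB.instance Definition _ :=
  isStarSemigroup.Build (unitization S) starM starK.

End Unitization.

(* The reproducing kernel Hilbert A-module of a kernel K : X * X -> A, given  *)
(* by its defining properties, which determine it uniquely. Its elements are  *)
(* functions X -> A via rkhm_ev; the module operations on functions are       *)
(* forced by rkhm_reproducing, see rkhm_evD, rkhm_evZ and rkhm_ev_act below.  *)
Record rkhm (R : realType) (A : cstarType R) (X : Type) (K : X -> X -> A) :=
  Rkhm {
    rkhm_space :> hilbertModType A ;
    rkhm_ev : rkhm_space -> X -> A ;
    rkhm_fun : X -> rkhm_space ;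
    rkhm_ev_inj : injective rkhm_ev ;
    rkhm_ev_fun : forall s t, rkhm_ev (rkhm_fun s) t = K s t ;
    rkhm_reproducing : forall F s, rkhm_ev F s = inner F (rkhm_fun s) ;
    rkhm_dense :
      closure (lin_span [set rkhm_fun s ◁ a | s in [set: X] & a in [set: A]])
        = [set: rkhm_space]
  }.

Section RkhmTheory.
Context (R : realType) (A : cstarType R) (X : Type) (K : X -> X -> A).
Context (E : rkhm K).

Lemma rkhm_evD (F G : E) s : rkhm_ev (F + G) s = rkhm_ev F s + rkhm_ev G s.
Proof.
by rewrite !rkhm_reproducing -inner_star innerDr cstarD !inner_star.
Qed.

Lemma rkhm_evZ (l : R[i]) (F : E) s :
  rkhm_ev (l *: F) s = l^*%C *: rkhm_ev F s.
Proof.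
by rewrite !rkhm_reproducing -inner_star innerZr cstarZ inner_star.
Qed.

Lemma rkhm_ev_act (F : E) a s : rkhm_ev (F ◁ a) s = a^† * rkhm_ev F s.
Proof.
by rewrite !rkhm_reproducing -inner_star inner_act [LHS]cstarM inner_star.
Qed.

Lemma rkhm_inner (s t : X) (a b : A) :
  inner (rkhm_fun E t ◁ b) (rkhm_fun E s ◁ a) = b^† * K t s * a.
Proof.
by rewrite inner_act -rkhm_reproducing rkhm_ev_act rkhm_ev_fun.
Qed.

End RkhmTheory.

Section PositiveDefinite.
Context (R : realType) (A : cstarType R) (S : starSemigroupType).
Implicit Type w : S -> A.

Definition kernel_of w (s t : S) : A := w (s^† * t)%g.

Definition pos_def w : Prop :=
  forall n (s : 'I_n -> S) (a : 'I_n -> A),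
    positive (\sum_k \sum_l (a k)^† * w ((s k)^† * s l)%g * a l).

Definition bounded_condition w : Prop :=
  forall s : S, exists2 c : R[i], 0 <= c &
    forall n (t : 'I_n -> S) (a : 'I_n -> A),
      `|\sum_i \sum_j (a i)^† * w ((t i)^† * s^† * s * t j)%g * a j|
      <= c * `|\sum_i \sum_j (a i)^† * w ((t i)^† * t j)%g * a j|.

(* T is the (unique) element of B*(E_w) extending the operator Phi_w(s),      *)
(* which is given on the span of the w_t ◁ a.                                 *)
Definition extends_Phi w (E : rkhm (kernel_of w)) (s : S) (T : 'B*(E, E)) :
    Prop :=
  forall n (t : 'I_n -> S) (a : 'I_n -> A),
    T (\sum_i rkhm_fun E (t i) ◁ a i) = \sum_i rkhm_fun E (s * t i)%g ◁ a i.

End PositiveDefinite.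

Definition extension_of (R : realType) (A : cstarType R)
    (S : starSemigroupType) (w : S -> A) (wp : unitization S -> A) : Prop :=
  pos_def wp /\ forall s, wp (base_elt s) = w s.

Definition extension_property (R : realType) (A : cstarType R)
    (S : starSemigroupType) (w : S -> A) : Prop :=
  exists wp : unitization S -> A, extension_of w wp.

(* Main.v *)
Require Import Defs.
From HB Require Import structures.
From mathcomp Require Import all_boot all_order all_algebra.
From mathcomp Require Import all_classical all_reals all_analysis.
From mathcomp Require Import complex ring lra.
Set Implicit Arguments.
Unset Strict Implicit.
Unset Printing Implicit Defensive.
Import Order.TTheory GRing.Theory Num.Theory.
Import numFieldNormedType.Exports.
Local Open Scope classical_set_scope.
Local Open Scope complex_scope.
Local Open Scope ring_scope.

(** Parts 2 and 3 rest on one observation: the element [f] of [E_w] that is the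
    function [w] satisfies [Phi s f = rkhm_fun E s] ([rkhm_ev_Phi] computes
    the values of [Phi s F] as those of [F] at [s^† * t]). Thus [f] behaves as the
    kernel section at a unit, whether or not there is a unit. With [V a = f ◁ a],
    the formulas for [V], its adjoint and [Phi] are the reproducing property,
    and minimality is the density of the combinations of kernel sections.

    For part 1, if the representation exists, then [Phi s] is adjointable,
    hence bounded ([adjointable_bounded]), and this is the boundedness condition.
    Conversely, an extension [wp] to the unitization gives a positive kernel,
    hence a reproducing kernel Hilbert module ([completion_rkhm]), and [V a] is
    the kernel section at the unit times [a]. The operators [Phi s] are obtained by
    closing the shift of combinations ([translate_limit]); this needs a bound on
    combinations over the unitization, while the boundedness condition speaks
    of combinations over [S] only. One application of Cauchy-Schwarz carries the
    bound over ([unitization_translate_bounded]).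

    All this requires positivity in C*-algebras: the elements [b^† * b] must form a
    closed convex cone on which the norm is monotone, for the Cauchy-Schwarz
    inequality ([gram_cauchy_schwarz]) and for the positivity of limits of inner
    products ([positive_closed]). The cone is described by norms ([cone]),
    and shown to consist of the squares of selfadjoint elements by means of a
    square root obtained by iteration ([root1]); that it contains every [b^† * b]
    ([cone_star_mul]) follows from the fact that such roots respect
    intertwining relations. *)

(** * Real norms and convergent sequences *)

Section RealNorm.
Context (R : realType).

Lemma ge0_complexE (c : R[i]) : 0 <= c -> c = (complex.Re c)%:C.
Proof. by rewrite lecE; case: c => a b /andP[/eqP /= -> _]. Qed.

Lemma gt0_complexE (c : R[i]) :
  0 < c -> 0 < complex.Re c /\ c = (complex.Re c)%:C.
Proof.
move=> c0; have cE := ge0_complexE (ltW c0).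
by split=> //; rewrite -ltcR -cE.
Qed.

(** Norms over [R[i]] are nonnegative reals in disguise; as elements of [R]
    they live in a total order, where linear arithmetic applies. *)
Definition rnorm (V : normedModType R[i]) (x : V) : R := complex.Re `|x|.

Lemma normE_rnorm (V : normedModType R[i]) (x : V) : `|x| = (rnorm x)%:C.
Proof. exact: ge0_complexE. Qed.

Context (V : normedModType R[i]).
Implicit Types x y z : V.

Lemma rnorm_ge0 x : 0 <= rnorm x.
Proof.
by have := normr_ge0 x; rewrite normE_rnorm lecE => /andP[].
Qed.

Lemma rnorm0 : rnorm (0 : V) = 0.
Proof. by rewrite /rnorm normr0. Qed.

Lemma rnorm0_eq0 x : rnorm x = 0 -> x = 0.
Proof. by move=> x0; apply/eqP; rewrite -normr_eq0 normE_rnorm x0. Qed.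

Lemma rnormN x : rnorm (- x) = rnorm x.
Proof. by rewrite /rnorm normrN. Qed.

Lemma rnormC x y : rnorm (x - y) = rnorm (y - x).
Proof. by rewrite -rnormN opprB. Qed.

Lemma rnormD x y : rnorm (x + y) <= rnorm x + rnorm y.
Proof. by rewrite -lecR rmorphD /= -!normE_rnorm ler_normD. Qed.

Lemma rnormB x y : rnorm (x - y) <= rnorm x + rnorm y.
Proof. by rewrite -(rnormN y) rnormD. Qed.

Lemma rnorm_triangle y x z : rnorm (x - z) <= rnorm (x - y) + rnorm (y - z).
Proof. by rewrite (le_trans _ (rnormD _ _))// subrKA. Qed.

Lemma rnorm_le_dist x y : rnorm x <= rnorm y + rnorm (x - y).
Proof. by rewrite -{1}(subrKC y x) rnormD. Qed.

Lemma rnormZ (t : R) x : rnorm (t%:C *: x) = `|t| * rnorm x.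
Proof.
apply: (@complexI R); rewrite -normE_rnorm normrZ normE_rnorm rmorphM /=.
by rewrite normc_def /= expr0n addr0 sqrtr_sqr.
Qed.

Lemma rnormZC (l : R[i]) x : rnorm (l *: x) = complex.Re `|l| * rnorm x.
Proof.
rewrite /rnorm normrZ (normE_rnorm x) normc_def /=; ring.
Qed.

Lemma rnorm_small x : (forall e, 0 < e -> rnorm x <= e) -> x = 0.
Proof.
move=> xs; apply: rnorm0_eq0; apply/eqP; rewrite eq_le rnorm_ge0 andbT.
by apply/ler_addgt0Pr => e e0; rewrite add0r xs.
Qed.

End RealNorm.

Section Sequences.
Context (R : realType) (V : normedModType R[i]).
Implicit Types (u v : nat -> V) (l : V).

(** Convergence along a sequence, with the real norm in place of the filters
    of the norm topology; [dominated_tends] is the passage between the two. *)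
Definition tends u l :=
  forall e : R, 0 < e -> exists N, forall n, (N <= n)%N -> rnorm (u n - l) <= e.

Lemma tends_unique u l l' : tends u l -> tends u l' -> l = l'.
Proof.
move=> ul ul'; apply/subr0_eq/rnorm_small => e e0.
have e20 : 0 < e / 2 by lra.
have [N uN] := ul _ e20; have [N' uN'] := ul' _ e20.
have := uN _ (leq_maxl N N'); have := uN' _ (leq_maxr N N').
set w := u _; rewrite (rnormC w l) => ? ?.
have := rnorm_triangle w l l'; lra.
Qed.

Lemma tends_le u v l l' (C : R) :
  (forall n, rnorm (v n - l') <= C * rnorm (u n - l)) ->
  tends u l -> tends v l'.
Proof.
move=> uv ul e e0; have C0 : 0 < `|C| + 1 by rewrite ltr_wpDl.
have [N uN] := ul _ (divr_gt0 e0 C0); exists N => n Nn.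
apply: (le_trans (uv n)); have := uN _ Nn.
rewrite ler_pdivlMr// mulrC; apply: le_trans.
by rewrite ler_wpM2r ?rnorm_ge0// (le_trans (ler_norm _))// lerDl.
Qed.

Lemma tends_cst l : tends (fun=> l) l.
Proof. by move=> e e0; exists 0%N => n _; rewrite subrr rnorm0 ltW. Qed.

Lemma tendsD u v l l' :
  tends u l -> tends v l' -> tends (fun n => u n + v n) (l + l').
Proof.
move=> ul vl e e0; have e20 : 0 < e / 2 by lra.
have [N uN] := ul _ e20; have [N' vN] := vl _ e20.
exists (maxn N N') => n; rewrite geq_max => /andP[/uN ? /vN ?].
rewrite opprD addrACA; apply: (le_trans (rnormD _ _)); lra.
Qed.

Lemma tendsZ (c : R[i]) u l : tends u l -> tends (fun n => c *: u n) (c *: l).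
Proof.
by apply: tends_le => n; rewrite -scalerBr rnormZC.
Qed.

Lemma tends_rnorm_le_near u l (M : R) N :
  (forall n, (N <= n)%N -> rnorm (u n) <= M) -> tends u l -> rnorm l <= M.
Proof.
move=> uM ul; apply/ler_addgt0Pr => e e0; have [N' uN] := ul _ e0.
have := uM _ (leq_maxl N N'); have := uN _ (leq_maxr N N').
by set n := maxn _ _; have := rnorm_le_dist l (u n); rewrite rnormC; lra.
Qed.

Lemma tends_rnorm_le u l (M : R) :
  (forall n, rnorm (u n) <= M) -> tends u l -> rnorm l <= M.
Proof. by move=> uM; apply: (@tends_rnorm_le_near _ _ _ 0%N). Qed.

End Sequences.

(** The way completeness is used throughout: the lengths of the steps of [u] are
    bounded by those of a bounded real sequence [s], which makes [u] Cauchy and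
    also bounds the distance to the limit by the rest of [s]. *)
Lemma dominated_tends (R : realType) (V : completeNormedModType R[i])
    (u : nat -> V) (s : nat -> R) (M : R) :
  (forall n, rnorm (u n.+1 - u n) <= s n.+1 - s n) -> (forall n, s n <= M) ->
  exists2 l, tends u l & forall n, rnorm (l - u n) <= M - s n.
Proof.
move=> us sM.
have le_dist n k : rnorm (u (n + k)%N - u n) <= s (n + k)%N - s n.
  elim: k => [|k IH]; first by rewrite addn0 !subrr rnorm0.
  rewrite addnS; apply: (le_trans (rnorm_triangle (u (n + k)%N) _ _)).
  by have := us (n + k)%N; lra.
(* after N, the bounded sequence s is within e of its supremum *)
have S : has_sup (range s).
  by split; [exists (s 0%N), 0%N | exists M => _ [n _ <-]].
have near e : 0 < e -> exists N, forall n, (N <= n)%N -> rnorm (u n - u N) < e.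
  move=> e0; have [_ [N _ <-] sN] := sup_adherent e0 S; exists N => n Nn.
  rewrite -(subnKC Nn) (le_lt_trans (le_dist _ _))//.
  have : s (N + (n - N))%N <= sup (range s).
    by apply: (ub_le_sup S.2); exists (N + (n - N))%N.
  lra.
have : cvg (u @ \oo).
  apply: cauchy_cvg; apply: cauchy_exP => e e0.
  have [e0' eE] := gt0_complexE e0.
  have [N uN] := near _ e0'; exists (u N).
  exists N => // n /= Nn.
  by rewrite -ball_normE /ball_ /= distrC normE_rnorm eE ltcR uN.
move=> /cvg_ex[l /cvgrPdist_le ul].
have {}ul : tends u l.
  move=> e e0; have e0' : 0 < e%:C by rewrite ltcR.
  have [N _ uN] := ul _ e0'; exists N => n Nn.
  by rewrite rnormC -lecR -normE_rnorm; exact: uN.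
exists l => // n; apply: (@tends_rnorm_le _ _ (fun k => u (n + k)%N - u n)).
  by move=> k; apply: (le_trans (le_dist n k)); rewrite lerB.
apply: tendsD; last exact: tends_cst.
move=> e /ul[N uN]; exists N => k Nk; apply: uN.
by rewrite (leq_trans Nk)// leq_addl.
Qed.

Lemma half_pow_gt0 (R : realType) n : 0 < 2^-1 ^+ n :> R.
Proof. by rewrite exprn_gt0 ?invr_gt0. Qed.

Lemma half_pow_small (R : realType) (e : R) : 0 < e ->
  exists N, forall n, (N <= n)%N -> 2^-1 ^+ n <= e.
Proof.
move=> e0; exists (Num.bound e^-1) => n Nn.
rewrite exprVn -[leRHS]invrK lef_pV2 ?posrE ?exprn_gt0 ?invr_gt0//.
have eV : e^-1 < (Num.bound e^-1)%:R.
  by apply: archi_boundP; rewrite invr_ge0 ltW.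
by rewrite (le_trans (ltW eV))// -natrX ler_nat (leq_trans Nn)// ltnW// ltn_expl.
Qed.

(** * The norm and the involution of a C*-algebra *)

Section CStarNorm.
Context (R : realType) (A : cstarType R).
Implicit Types (a b x y z : A) (t : R).

(** The axioms of the algebra speak of [cmul]; the lemmas below are the same
    rules for the product of the derived ring structure. *)
Lemma scale_mull (l : R[i]) a b : (l *: a) * b = l *: (a * b).
Proof. exact: cmulZl. Qed.

Lemma scale_mulr (l : R[i]) a b : a * (l *: b) = l *: (a * b).
Proof. exact: cmulZr. Qed.

Lemma starM a b : (a * b)^† = b^† * a^†.
Proof. exact: cstarM. Qed.

Lemma starK a : a^†^† = a.
Proof. exact: cstarK. Qed.

Lemma starZ (l : R[i]) a : (l *: a)^† = l^*%C *: a^†.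
Proof. exact: cstarZ. Qed.

Lemma starZR t a : (t%:C *: a)^† = t%:C *: a^†.
Proof. by rewrite starZ conjc_real. Qed.

Lemma starD a b : (a + b)^† = a^† + b^†.
Proof. exact: cstarD. Qed.

Lemma star0 : (0 : A)^† = 0.
Proof. by apply: (addIr (0 : A)^†); rewrite -starD !addr0 add0r. Qed.

Lemma starN a : (- a)^† = - a^†.
Proof. by apply: (addIr a^†); rewrite -starD !addNr star0. Qed.

Lemma starB a b : (a - b)^† = a^† - b^†.
Proof. by rewrite starD starN. Qed.

Lemma star1 : (1 : A)^† = 1.
Proof. by rewrite -[RHS]starK -(mulr1 (1 : A)^†) starM starK. Qed.

Lemma rnormM a b : rnorm (a * b) <= rnorm a * rnorm b.
Proof. by rewrite -lecR rmorphM /= -!normE_rnorm; exact: normcM. Qed.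

Lemma rnorm_starM a : rnorm (a^† * a) = rnorm a ^+ 2.
Proof.
by apply: (@complexI R); rewrite rmorphXn /= -!normE_rnorm; exact: normc_cstar.
Qed.

Lemma rnorm_star a : rnorm a^† = rnorm a.
Proof.
have le_cs b : rnorm b <= rnorm b^†.
  have := rnorm_ge0 b; rewrite le_eqVlt => /orP[/eqP<-|b0].
    exact: rnorm_ge0.
  by rewrite -(ler_pM2r b0) -expr2 -rnorm_starM rnormM.
by apply/eqP; rewrite eq_le le_cs andbT -{2}(starK a) le_cs.
Qed.

Lemma rnorm1_le1 : rnorm (1 : A) <= 1.
Proof.
have := rnorm_starM (1 : A); rewrite star1 mul1r => /eqP; rewrite -subr_eq0.
rewrite expr2 -{1}(mulr1 (rnorm (1 : A))) -mulrBr mulf_eq0 subr_eq0.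
by case/orP => /eqP; [move=> -> | move=> <-].
Qed.

Lemma rnorm_scalar t : 0 <= t -> rnorm (t%:C *: (1 : A)) <= t.
Proof.
by move=> t0; rewrite rnormZ ger0_norm// ler_piMr// rnorm1_le1.
Qed.

Lemma rnorm_selfadj a : a^† = a -> rnorm (a * a) = rnorm a ^+ 2.
Proof. by move=> {1}<-; exact: rnorm_starM. Qed.

Lemma selfadj_sq_eq0 a : a^† = a -> a * a = 0 -> a = 0.
Proof.
move=> sa a0; apply: rnorm0_eq0; apply/eqP.
by rewrite -sqrf_eq0 -rnorm_selfadj// a0 rnorm0.
Qed.

Lemma tends_mull (u : nat -> A) a b :
  tends u a -> tends (fun n => b * u n) (b * a).
Proof. by apply: tends_le => n; rewrite -mulrBr; exact: rnormM. Qed.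

Lemma tends_mulr (u : nat -> A) a b :
  tends u a -> tends (fun n => u n * b) (a * b).
Proof.
by apply: tends_le => n; rewrite -mulrBl mulrC; exact: rnormM.
Qed.

Lemma tends_star (u : nat -> A) a : tends u a -> tends (fun n => (u n)^†) a^†.
Proof. by apply: (@tends_le _ _ _ _ _ _ 1) => n; rewrite -starB rnorm_star mul1r. Qed.

Lemma tends_sq (u : nat -> A) a (M : R) :
  (forall n, rnorm (u n) <= M) -> tends u a ->
  tends (fun n => u n * u n) (a * a).
Proof.
move=> uM ua; apply: (tends_le (C := M + M) _ ua) => n.
have -> : u n * u n - a * a = u n * (u n - a) + (u n - a) * a.
  by rewrite mulrBr mulrBl addrA subrK.
apply: (le_trans (rnormD _ _)); rewrite [leRHS]mulrDl.
apply: lerD; apply: (le_trans (rnormM _ _)).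
  by rewrite ler_wpM2r ?rnorm_ge0.
by rewrite mulrC ler_wpM2r ?rnorm_ge0// (tends_rnorm_le uM).
Qed.

End CStarNorm.

(** * Square roots *)

Section SquareRoot.
Context (R : realType) (A : cstarType R).
Implicit Types (a b x y z h g p q : A) (t : R).
Local Notation sca t := (t%:C *: (1 : A)).

(** The iteration [y |-> (x + y ^+ 2) / 2], whose fixed points are the [y] with
    [(1 - y) ^+ 2 = 1 - x]. *)
Fixpoint root_seq x n : A :=
  if n is n'.+1 then (2^-1)%:C *: (x + root_seq x n' * root_seq x n') else 0.

(** The same iteration at [x = 1] in the reals: it majorizes [root_seq] term by
    term, because each [root_seq x n] is a polynomial in [x] with nonnegative
    coefficients. *)
Fixpoint root_bound n : R :=
  if n is n'.+1 then (1 + root_bound n' ^+ 2) / 2 else 0.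

Lemma root_bound_itv n : 0 <= root_bound n <= 1.
Proof.
elim: n => /= [|n /andP[s0 s1]]; first by rewrite lexx ler01.
by apply/andP; split; nra.
Qed.

Lemma root_seq_bounds x n : rnorm x <= 1 ->
  [/\ rnorm (root_seq x n) <= root_bound n
    & rnorm (root_seq x n.+1 - root_seq x n)
      <= root_bound n.+1 - root_bound n].
Proof.
move=> x1.
have half_norm y : rnorm ((2^-1)%:C *: y) = rnorm y / 2.
  by rewrite rnormZ ger0_norm 1?mulrC// invr_ge0.
elim: n => [|n [IH1 IH2]].
  rewrite /= !rnorm0 mulr0 !addr0 subr0 half_norm expr0n addr0.
  by split=> //; lra.
have b1 : rnorm (root_seq x n.+1) <= root_bound n.+1.
  rewrite /= half_norm ler_wpM2r ?invr_ge0//.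
  apply: (le_trans (rnormD _ _)); apply: lerD => //.
  apply: (le_trans (rnormM _ _)); rewrite expr2.
  by apply: ler_pM => //; exact: rnorm_ge0.
split=> //; set y' := root_seq x n.+1 in IH2 b1 *.
set y := root_seq x n in IH1 IH2 *.
have -> : root_seq x n.+2 - y' = (2^-1)%:C *: (y' * (y' - y) + (y' - y) * y).
  rewrite [root_seq x n.+2]/= -/y' {2}/y' /= -/y -scalerBr; congr (_ *: _).
  by rewrite mulrBr mulrBl addrA subrK opprD addrACA subrr add0r.
set s' := root_bound n.+1 in IH2 b1 *; set s := root_bound n in IH1 IH2 *.
have -> : root_bound n.+2 - s' = (s' * (s' - s) + (s' - s) * s) / 2.
  have s'E : s' = (1 + s ^+ 2) / 2 by [].
  have -> : root_bound n.+2 = (1 + s' ^+ 2) / 2 by [].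
  by move: s'E; lra.
rewrite half_norm ler_wpM2r ?invr_ge0//.
apply: (le_trans (rnormD _ _)); apply: lerD; apply: (le_trans (rnormM _ _));
  by apply: ler_pM => //; exact: rnorm_ge0.
Qed.

Definition root1 x : A := xget 0 [set y | tends (root_seq x) y].

Lemma root1_tends x : rnorm x <= 1 -> tends (root_seq x) (root1 x).
Proof.
move=> x1; have [l xl _] : exists2 l, tends (root_seq x) l &
    forall n, rnorm (l - root_seq x n) <= 1 - root_bound n.
  apply: dominated_tends => n.
    by case: (root_seq_bounds n x1).
  by case/andP: (root_bound_itv n).
exact: (@xgetPex _ 0 [set y | tends (root_seq x) y]) (ex_intro _ l xl).
Qed.

Lemma root_seq_le1 x n : rnorm x <= 1 -> rnorm (root_seq x n) <= 1.
Proof.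
move=> x1; have [+ _] := root_seq_bounds n x1.
by case/andP: (root_bound_itv n) => _ /[swap]; exact: le_trans.
Qed.

Lemma root1_le1 x : rnorm x <= 1 -> rnorm (root1 x) <= 1.
Proof.
move=> x1; apply: (tends_rnorm_le _ (root1_tends x1)) => n.
exact: root_seq_le1.
Qed.

Lemma root1_sq x : rnorm x <= 1 -> (1 - root1 x) * (1 - root1 x) = 1 - x.
Proof.
move=> x1; have xr := root1_tends x1; set r := root1 x in xr *.
have rE : r = (2^-1)%:C *: (x + r * r).
  apply: (@tends_unique _ _ (fun n => root_seq x n.+1)).
    by move=> e /xr[N xN]; exists N => n Nn; apply: xN; exact: leqW.
  apply: tendsZ; apply: tendsD; first exact: tends_cst.
  by apply: (@tends_sq _ _ _ _ 1) => // n; exact: root_seq_le1.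
have r2E : r + r = x + r * r.
  rewrite {1 2}rE -scalerDl -rmorphD /=.
  by rewrite [X in X%:C](_ : _ = 1) ?scale1r//; field.
rewrite mulrBr mulr1 mulrBl mul1r opprB addrCA -[1 - r - r]addrA -opprD r2E.
by rewrite opprD [1 + (_ + _)]addrA [LHS]addrC subrK.
Qed.

Lemma root1_selfadj x : rnorm x <= 1 -> x^† = x -> (root1 x)^† = root1 x.
Proof.
move=> x1 sx; have xr := root1_tends x1.
apply: (tends_unique (tends_star xr)).
suff E n : (root_seq x n)^† = root_seq x n by under eq_fun do rewrite E.
by elim: n => [|n IH] /=; rewrite ?star0// starZR starD starM IH sx.
Qed.

(** The square root is a limit of polynomials in [x], so it inherits
    intertwining relations; with [x' = x] this says that it commutes with
    everything that commutes with [x]. *)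
Lemma root1_intertwine x x' z : rnorm x <= 1 -> rnorm x' <= 1 ->
  x * z = z * x' -> root1 x * z = z * root1 x'.
Proof.
move=> x1 x'1 xz.
apply: (@tends_unique _ _ (fun n => root_seq x n * z)).
  exact/tends_mulr/root1_tends.
suff E n : root_seq x n * z = z * root_seq x' n.
  by under eq_fun do rewrite E; exact/tends_mull/root1_tends.
elim: n => [|n IH] /=; first by rewrite mul0r mulr0.
by rewrite scale_mull scale_mulr mulrDl mulrDr xz -mulrA IH mulrA IH mulrA.
Qed.

(** The square root of [a], computed from that of [a / t]; the same [t] must serve
    for two elements if their roots are to be intertwined. *)
Definition sqroot t a : A :=
  (Num.sqrt t)%:C *: (1 - root1 (1 - (t^-1)%:C *: a)).

(** A selfadjoint element is within [t] of the scalar [t] when its spectrum lies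
    between [0] and [2 t]: this is positivity expressed by norms alone, from
    which convexity and closedness can be read off. *)
Definition cone a : Prop :=
  a^† = a /\ exists t, rnorm (sca t - a) <= t.

Section Bounded.
Variable t : R.
Hypothesis t_gt0 : 0 < t.

Lemma sqroot_arg a : rnorm (sca t - a) <= t ->
  rnorm (1 - (t^-1)%:C *: a) <= 1.
Proof.
move=> ta; have -> : 1 - (t^-1)%:C *: a = (t^-1)%:C *: (sca t - a).
  by rewrite scalerBr scalerA -rmorphM /= mulVf ?gt_eqF// scale1r.
by rewrite rnormZ gtr0_norm ?invr_gt0// mulrC ler_pdivrMr// mul1r.
Qed.

Lemma sqroot_sq a : rnorm (sca t - a) <= t ->
  sqroot t a * sqroot t a = a.
Proof.
move=> ta; rewrite scale_mull scale_mulr root1_sq ?sqroot_arg// subKr.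
rewrite !scalerA -!rmorphM /=.
by rewrite -expr2 sqr_sqrtr ?ltW// divff ?gt_eqF// scale1r.
Qed.

Lemma sqroot_selfadj a : a^† = a -> rnorm (sca t - a) <= t ->
  (sqroot t a)^† = sqroot t a.
Proof.
move=> sa ta; rewrite starZR starB star1 root1_selfadj ?sqroot_arg//.
by rewrite starB star1 starZR sa.
Qed.

Lemma sqroot_cone a : a^† = a -> rnorm (sca t - a) <= t ->
  cone (sqroot t a).
Proof.
move=> sa ta; split; first exact: sqroot_selfadj.
exists (Num.sqrt t); rewrite -scalerBr subKr rnormZ ger0_norm ?sqrtr_ge0//.
by rewrite ler_piMr ?sqrtr_ge0// root1_le1// sqroot_arg.
Qed.

Lemma sqroot_intertwine a a' z : rnorm (sca t - a) <= t ->
  rnorm (sca t - a') <= t ->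
  a * z = z * a' -> sqroot t a * z = z * sqroot t a'.
Proof.
move=> ta ta' az; rewrite scale_mull scale_mulr mulrBl mulrBr mul1r mulr1.
rewrite (root1_intertwine _ _ (x' := 1 - (t^-1)%:C *: a')) ?sqroot_arg//.
by rewrite mulrBl mulrBr mul1r mulr1 scale_mull scale_mulr az.
Qed.

End Bounded.

(** [u = h + i g] has [u^† * u = t], so [rnorm u ^+ 2 <= t], and [h] is the real
    part of [u]. *)
Lemma commuting_squares_bound t h g : h^† = h -> g^† = g -> h * g = g * h ->
  h * h + g * g = sca t -> 0 <= t -> rnorm (h * h) <= t.
Proof.
move=> sh sg hg hhgg t0; pose u := h + 'i%C *: g.
have su : u^† = h - 'i%C *: g.
  rewrite starD starZ sh sg -scaleNr; congr (_ + _ *: _).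
  by apply/eqP; rewrite eq_complex /= oppr0 !eqxx.
have uu : rnorm u ^+ 2 <= t.
  rewrite -rnorm_starM su mulrDr !mulrBl !scale_mull !scale_mulr hg scalerA.
  rewrite ['i%C * _]sqr_i scaleN1r opprK addrA subrK hhgg.
  exact: rnorm_scalar.
have hE : h = (2^-1)%:C *: (u + u^†).
  rewrite su addrACA subrr addr0 scalerDr -scalerDl -rmorphD /=.
  by rewrite [X in X%:C](_ : _ = 1) ?scale1r//; field.
rewrite rnorm_selfadj//; apply: le_trans uu.
rewrite lerXn2r ?nnegrE ?rnorm_ge0// hE rnormZ ger0_norm ?invr_ge0//.
have := rnormD u u^†; rewrite rnorm_star; lra.
Qed.

(** Complete [h * h] to [t] with the square of [g = sqroot t (t - h * h)], which
    commutes with [h], and exchange the roles of [h] and [g] in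
    [commuting_squares_bound]. *)
Lemma square_dist_le t h : h^† = h -> rnorm (h * h) <= t -> 0 < t ->
  rnorm (sca t - h * h) <= t.
Proof.
move=> sh ht t0.
have st : (sca t - h * h)^† = sca t - h * h by rewrite starB starZR star1 starM sh.
have dt : rnorm (sca t - (sca t - h * h)) <= t by rewrite subKr.
have g2 := sqroot_sq t0 dt; set g := sqroot t _ in g2 *.
rewrite -g2; apply: (commuting_squares_bound (g := h)) (ltW t0) => //.
- exact: sqroot_selfadj.
- apply: sqroot_intertwine => //.
  by rewrite mulrBl mulrBr mulrA scale_mull scale_mulr mul1r mulr1.
- by rewrite g2 subrK.
Qed.

End SquareRoot.

(** * The positive cone *)

Section Positivity.
Context (R : realType) (A : cstarType R).
Implicit Types (a b c h g m p q v x y z : A) (t : R).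
Local Notation sca t := (t%:C *: (1 : A)).

Lemma cone_witness a : cone a ->
  exists2 t, 0 < t & rnorm (sca t - a) <= t.
Proof.
case=> _ [t ta]; have t0 : 0 <= t := le_trans (rnorm_ge0 _) ta.
exists (t + 1); first by rewrite ltr_wpDl.
rewrite rmorphD scalerDl addrAC; apply: (le_trans (rnormD _ _)).
by rewrite lerD// rnorm_scalar.
Qed.

Lemma cone_sqroot a : cone a -> exists h,
  [/\ h^† = h, h * h = a & forall z, a * z = z * a -> h * z = z * h].
Proof.
move=> Pa; have [t t0 ta] := cone_witness Pa; have [sa _] := Pa.
exists (sqroot t a); split; [exact: sqroot_selfadj|exact: sqroot_sq|].
by move=> z az; apply: sqroot_intertwine.
Qed.

Lemma cone_sq h : h^† = h -> cone (h * h).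
Proof.
move=> sh; split; first by rewrite starM sh.
exists (rnorm (h * h) + 1); apply: square_dist_le => //; first by rewrite lerDl.
by rewrite ltr_wpDl ?rnorm_ge0.
Qed.

Lemma cone_dist_le a t : cone a -> rnorm a <= t -> rnorm (sca t - a) <= t.
Proof.
move=> /cone_sqroot[h [sh <- _]] ht.
have := le_trans (rnorm_ge0 _) ht; rewrite le_eqVlt => /orP[/eqP t0|t0].
  move: ht; rewrite -t0 => ht.
  have -> : h * h = 0.
    by apply: rnorm0_eq0; apply/eqP; rewrite eq_le ht rnorm_ge0.
  by rewrite subr0 scale0r rnorm0.
exact: square_dist_le.
Qed.

Lemma cone_sub t a : cone a -> rnorm a <= t -> cone (sca t - a).
Proof.
by move=> Pa ta; split; [rewrite starB starZR star1 Pa.1|exists t; rewrite subKr].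
Qed.

Lemma coneD a b : cone a -> cone b -> cone (a + b).
Proof.
move=> [sa [t ta]] [sb [u ub]]; split; first by rewrite starD sa sb.
exists (t + u); rewrite rmorphD scalerDl opprD addrACA.
by apply: (le_trans (rnormD _ _)); apply: lerD.
Qed.

Lemma coneZ t a : 0 <= t -> cone a -> cone (t%:C *: a).
Proof.
move=> t0 [sa [u ua]]; split; first by rewrite starZR sa.
exists (t * u); rewrite rmorphM -scalerA -scalerBr rnormZ ger0_norm//.
exact: ler_wpM2l.
Qed.

(** The square roots of [p] and of [t - p] commute, and their squares add up to
    [t]. *)
Lemma cone_le_rnorm t p : cone p -> cone (sca t - p) -> 0 <= t -> rnorm p <= t.
Proof.
move=> /cone_sqroot[h [sh <- comm_h]] /cone_sqroot[g [sg gE comm_g]] t0.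
apply: (@commuting_squares_bound _ _ t h g) => //; last by rewrite gE subrKC.
apply: comm_h; apply/esym/comm_g.
by rewrite mulrBl mulrBr scale_mull scale_mulr mul1r mulr1.
Qed.

Lemma cone_rnorm_leD p q : cone p -> cone q -> rnorm p <= rnorm (p + q).
Proof.
move=> Pp Pq; apply: cone_le_rnorm; rewrite ?rnorm_ge0//.
rewrite (_ : _ - p = (sca (rnorm (p + q)) - (p + q)) + q).
  by apply: coneD => //; apply: cone_sub => //; exact: coneD.
by rewrite opprD addrA subrK.
Qed.

Lemma cone_anti p : cone p -> cone (- p) -> p = 0.
Proof.
move=> Pp /(cone_rnorm_leD Pp); rewrite subrr rnorm0 => p0.
by apply: rnorm0_eq0; apply/eqP; rewrite eq_le p0 rnorm_ge0.
Qed.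

(** It is [2 (x ^+ 2 + y ^+ 2)] for the real part [x] and the imaginary part [y]
    of [c]. *)
Lemma cone_anticommutator c : cone (c^† * c + c * c^†).
Proof.
have Px : cone ((c + c^†) * (c + c^†)) by apply: cone_sq; rewrite starD starK addrC.
have Py : cone (('i%C *: (c - c^†)) * ('i%C *: (c - c^†))).
  apply: cone_sq; rewrite starZ starB starK -opprB scalerN -scaleNr; congr (_ *: _).
  by apply/eqP; rewrite eq_complex /= oppr0 opprK !eqxx.
have -> : c^† * c + c * c^† = (2^-1)%:C *: ((c + c^†) * (c + c^†)
    + ('i%C *: (c - c^†)) * ('i%C *: (c - c^†))).
  rewrite scale_mull scale_mulr scalerA ['i%C * _]sqr_i scaleN1r.
  set d := c^†; rewrite !mulrBr !mulrBl !mulrDr !mulrDl.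
  set x := c * c; set y := d * d; set u := d * c; set v := c * d.
  have -> : x + u + (v + y) - (x - u - (v - y)) = (u + v) + (u + v).
    have -> : - (x - u - (v - y)) = - x + u + (v - y).
      by rewrite opprB opprD opprK addrC.
    rewrite addrACA [x + u + _]addrACA subrr add0r.
    by rewrite [v + y + _]addrACA subrr addr0 addrACA.
  rewrite scalerDr -scalerDl -rmorphD /=.
  by rewrite [X in X%:C](_ : _ = 1) ?scale1r//; field.
by apply: coneZ; [rewrite invr_ge0|exact: coneD].
Qed.

(** [m] plays the absolute value of [a]; then [m - a] is twice the negative part
    of [a], and since [(m - a) * a = - m * (m - a)] the element in question is
    [m * (m - a) ^+ 2], the square of [g * (m - a)] with [g ^+ 2 = m]. *)
Lemma cone_abs_defect a m : a^† = a -> cone m -> m * m = a * a ->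
  a * m = m * a -> cone (- ((m - a) * a * (m - a))).
Proof.
move=> sa Pm mm am; have [g [sg gg comm_g]] := cone_sqroot Pm.
set d := m - a; have sd : d^† = d by rewrite starB sa Pm.1.
have dm : m * d = d * m by rewrite /d mulrBr mulrBl am.
have -> : - (d * a * d) = (g * d) * (g * d).
  have -> : d * a = - (m * d) by rewrite /d mulrBl mulrBr mm opprB.
  by rewrite mulNr opprK -gg -mulrA [RHS]mulrA -[g * d * g]mulrA -comm_g// !mulrA.
by apply: cone_sq; rewrite starM sd sg comm_g.
Qed.

(** Let [a = b^† * b] and [a' = b * b^†], with absolute values [m] and [m']. Since
    [b * a ^+ 2 = a' ^+ 2 * b], also [b * m = m' * b], so that
    [c = b * (m - a) = (m' - a') * b]. Both [- c^† * c] and [- c * c^†] are in the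
    cone by [cone_abs_defect], while [c^† * c + c * c^†] is in it as well; hence
    [c = 0], which means [m * a = a * a] and then [m = a]. The
    intertwining of the two absolute values plays the part of the usual
    comparison of the spectra of [c^† * c] and [c * c^†]. *)
Lemma cone_star_mul b : cone (b^† * b).
Proof.
set a := b^† * b; set a' := b * b^†.
have sa : a^† = a by rewrite starM starK.
have sa' : a'^† = a' by rewrite starM starK.
pose t := rnorm (a * a) + rnorm (a' * a') + 1.
have t0 : 0 < t by rewrite ltr_wpDl// addr_ge0 ?rnorm_ge0.
have ta : rnorm (sca t - a * a) <= t.
  apply: square_dist_le => //.
  by rewrite /t; have := rnorm_ge0 (a' * a'); lra.
have ta' : rnorm (sca t - a' * a') <= t.
  apply: square_dist_le => //.
  by rewrite /t; have := rnorm_ge0 (a * a); lra.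
have sq h : h^† = h -> (h * h)^† = h * h by move=> sh; rewrite starM sh.
pose m := sqroot t (a * a); pose m' := sqroot t (a' * a').
have Pm : cone m by apply: sqroot_cone => //; exact: sq.
have Pm' : cone m' by apply: sqroot_cone => //; exact: sq.
have mm : m * m = a * a by exact: sqroot_sq.
have mm' : m' * m' = a' * a' by exact: sqroot_sq.
have am : a * m = m * a.
  by symmetry; apply: sqroot_intertwine => //; exact/esym/mulrA.
have am' : a' * m' = m' * a'.
  by symmetry; apply: sqroot_intertwine => //; exact/esym/mulrA.
have bm : b * m = m' * b.
  by symmetry; apply: sqroot_intertwine => //; rewrite /a /a' !mulrA.
pose c := b * (m - a).
have cE : c = (m' - a') * b by rewrite /c mulrBr mulrBl bm /a /a' !mulrA.
have Nc : cone (- (c^† * c)).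
  have -> : c^† * c = (m - a) * a * (m - a).
    by rewrite /c starM starB sa Pm.1 /a !mulrA.
  exact: cone_abs_defect.
have Nc' : cone (- (c * c^†)).
  have -> : c * c^† = (m' - a') * a' * (m' - a').
    by rewrite cE starM starB sa' Pm'.1 /a' !mulrA.
  exact: cone_abs_defect.
have cc0 : c^† * c + c * c^† = 0.
  apply: cone_anti; first exact: cone_anticommutator.
  by rewrite opprD; exact: coneD.
have c0 : c = 0.
  apply: rnorm0_eq0; apply/eqP; rewrite -sqrf_eq0 -rnorm_starM.
  rewrite (cone_anti (p := c^† * c)) ?rnorm0// -[c^† * c]opprK.
  rewrite (_ : - (c^† * c) = c * c^†) //.
  by apply/eqP; rewrite eq_sym -addr_eq0 addrC cc0.
have ma : m * a = a * a.
  rewrite -am /a -mulrA -[RHS]mulrA; congr (_ * _); apply/subr0_eq.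
  by rewrite -mulrBr.
suff <- : m = a by [].
apply/subr0_eq/selfadj_sq_eq0; first by rewrite starB sa Pm.1.
by rewrite mulrBl !mulrBr mm am ma !subrr.
Qed.

Lemma positiveP a : positive a <-> cone a.
Proof.
split=> [[b ->]|/cone_sqroot[h [sh <- _]]]; first exact: cone_star_mul.
by exists h; rewrite sh.
Qed.

Lemma positive_closed v :
  (forall e, 0 < e -> exists2 p, positive p & rnorm (v - p) <= e) ->
  positive v.
Proof.
move=> vp; apply/positiveP; split.
  apply/subr0_eq/rnorm_small => e e0.
  have [p /positiveP Pp vpe] := vp _ (divr_gt0 e0 (ltr0Sn _ 1)).
  have := rnorm_triangle p v^† v; rewrite -{1}Pp.1 -starB rnorm_star (rnormC p v).
  by move: vpe; lra.
exists (rnorm v); apply/ler_addgt0Pr => e e0.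
have e3 : 0 < e / 3 by rewrite divr_gt0.
have [p /positiveP Pp vpe] := vp _ e3.
pose t := rnorm v + e / 3.
have pt : rnorm p <= t.
  by have := rnorm_le_dist p v; rewrite rnormC /t; move: vpe; lra.
have tp := cone_dist_le Pp pt.
have vt : rnorm (sca (rnorm v) - sca t) <= e / 3.
  by rewrite rnormC -scalerBl -rmorphB /t [_ + e / 3]addrC addrK rnorm_scalar// ltW.
have := rnorm_triangle (sca t) (sca (rnorm v)) v.
have := rnorm_triangle p (sca t) v; rewrite (rnormC p v).
by move: tp vt vpe; rewrite {2}/t; lra.
Qed.

(** Cauchy-Schwarz for a positive 2 by 2 matrix over [A] with diagonal [p], [q]
    and corner [a], such as the Gram matrix of two vectors of a module. For
    [t >= rnorm p], [p] is below [t]; the form at [x = - a / t], [y = 1] is then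
    at most [q - (a^† * a) / t], and norms are monotone on the cone. *)
Lemma gram_cauchy_schwarz p q a :
  (forall x y, positive
    (x^† * p * x + x^† * a * y + (y^† * a^† * x + y^† * q * y))) ->
  rnorm a ^+ 2 <= rnorm p * rnorm q.
Proof.
move=> gram.
have Pp : cone p.
  have /positiveP := gram 1 0; rewrite star1 star0 !mul0r mulr0 !addr0 mul1r mulr1.
  by [].
have bound t : 0 < t -> rnorm p <= t -> rnorm a ^+ 2 <= t * rnorm q.
  move=> t0 pt; have /positiveP := gram (- (t^-1)%:C *: a) 1.
  have [h [sh hh _]] := cone_sqroot (cone_sub Pp pt).
  have := coneZ (sqr_ge0 t^-1) (cone_star_mul (h * a)).
  rewrite starM sh mulrA -[_ * h * h]mulrA hh => P1 P2; have := coneD P1 P2.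
  have -> : (t^-1 ^+ 2)%:C *: (a^† * (sca t - p) * a) =
      (t^-1)%:C *: (a^† * a) - (t^-1 ^+ 2)%:C *: (a^† * p * a).
    rewrite mulrBr mulrBl scale_mulr mulr1 scale_mull scalerBr scalerA -rmorphM /=.
    by congr (_%:C *: _ - _); rewrite expr2 -mulrA mulVf ?gt_eqF// mulr1.
  rewrite star1 !mul1r !mulr1 -rmorphN starZR !scale_mull !scale_mulr.
  rewrite !scalerA -!rmorphM /=.
  rewrite mulrNN -expr2; set r := t^-1; set u := a^† * p * a.
  set w := a^† * a => P3.
  have {P3} Pd : cone (q - r%:C *: w).
    move: P3; rewrite rmorphN scaleNr.
    have -> : r%:C *: w - (r ^+ 2)%:C *: u +
        ((r ^+ 2)%:C *: u - r%:C *: w + (- (r%:C *: w) + q)) = q - r%:C *: w.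
      by rewrite [LHS]addrA subrKA subrr add0r addrC.
    by [].
  have Pw : cone (r%:C *: w).
    by apply: coneZ; [rewrite invr_ge0 ltW|exact: cone_star_mul].
  have := cone_rnorm_leD Pw Pd; rewrite subrKC rnormZ gtr0_norm ?invr_gt0//.
  by rewrite rnorm_starM mulrC ler_pdivrMr// mulrC.
have q0 := rnorm_ge0 q.
have := rnorm_ge0 p; rewrite le_eqVlt => /orP[/eqP p0|p0]; last exact: bound.
apply/ler_addgt0Pr => e e0; rewrite -p0 mul0r add0r.
have q1 : 0 < rnorm q + 1 by rewrite ltr_wpDl.
apply: (le_trans (bound (e / (rnorm q + 1)) _ _)); first exact: divr_gt0.
  by rewrite -p0 ltW// divr_gt0.
by rewrite mulrAC ler_pdivrMr// ler_wpM2l ?ltW// ltrDl.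
Qed.

End Positivity.

(** * Hilbert modules *)

Section HilbertModule.
Context (R : realType) (A : cstarType R) (E : hilbertModType A).
Implicit Types (x y z : E) (a b : A).

Lemma rnorm_inner x : rnorm x ^+ 2 = rnorm (inner x x).
Proof.
apply: (@complexI R); rewrite rmorphXn /= -!normE_rnorm normE sqrtCK.
by [].
Qed.

Lemma innerDl x y z : inner (x + y) z = inner x z + inner y z.
Proof. by rewrite -inner_star innerDr starD !inner_star. Qed.

Lemma inner_actl x y a : inner (x ◁ a) y = a^† * inner x y.
Proof. by rewrite -inner_star inner_act starM inner_star. Qed.

Lemma inner0r x : inner x 0 = 0.
Proof. by apply: (addIr (inner x 0)); rewrite -innerDr !add0r. Qed.

Lemma inner0l x : inner 0 x = 0.
Proof. by rewrite -inner_star inner0r star0. Qed.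

Lemma innerBr x y z : inner x (y - z) = inner x y - inner x z.
Proof. by apply: (addIr (inner x z)); rewrite -innerDr !subrK. Qed.

Lemma innerBl x y z : inner (x - y) z = inner x z - inner y z.
Proof. by apply: (addIr (inner y z)); rewrite -innerDl !subrK. Qed.

Lemma act0r x : x ◁ (0 : A) = 0.
Proof. by apply: (addIr (x ◁ (0 : A))); rewrite -actDr !add0r. Qed.

Lemma actNr x a : x ◁ - a = - (x ◁ a).
Proof. by apply: (addIr (x ◁ a)); rewrite -actDr !addNr act0r. Qed.

Lemma act0l a : (0 : E) ◁ a = 0.
Proof. by apply: (addIr ((0 : E) ◁ a)); rewrite -actDl !add0r. Qed.

Lemma act_suml I (r : seq I) (F : I -> E) a :
  (\sum_(i <- r) F i) ◁ a = \sum_(i <- r) F i ◁ a.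
Proof. by elim/big_rec2: _ => [|i u v _ <-]; rewrite ?act0l// actDl. Qed.

Lemma inner_sumr I (r : seq I) x (F : I -> E) :
  inner x (\sum_(i <- r) F i) = \sum_(i <- r) inner x (F i).
Proof. by elim/big_rec2: _ => [|i u v _ <-]; rewrite ?inner0r// innerDr. Qed.

Lemma inner_suml I (r : seq I) x (F : I -> E) :
  inner (\sum_(i <- r) F i) x = \sum_(i <- r) inner (F i) x.
Proof. by elim/big_rec2: _ => [|i u v _ <-]; rewrite ?inner0l// innerDl. Qed.

Lemma inner_ext x y : (forall z, inner x z = inner y z) -> x = y.
Proof.
move=> xy; apply/subr0_eq/rnorm0_eq0/eqP; rewrite -sqrf_eq0 rnorm_inner.
by rewrite innerBl xy subrr rnorm0.
Qed.

Lemma cauchy_schwarz x y : rnorm (inner x y) <= rnorm x * rnorm y.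
Proof.
rewrite -ler_sqr ?nnegrE ?mulr_ge0 ?rnorm_ge0//.
rewrite exprMn !rnorm_inner; apply: gram_cauchy_schwarz => a b.
have := inner_ge0 (x ◁ a + y ◁ b).
by rewrite innerDl !innerDr !inner_actl !inner_act !inner_star !mulrA.
Qed.

Lemma tends_inner (u v : nat -> E) x y : tends u x -> tends v y ->
  tends (fun n => inner (u n) (v n)) (inner x y).
Proof.
move=> ux vy e e0.
pose M := rnorm x + rnorm y + 1.
have M0 : 0 < M by rewrite ltr_wpDl// addr_ge0 ?rnorm_ge0.
pose d := Num.min 1 (e / (2 * M)).
have d0 : 0 < d by rewrite lt_min ltr01 divr_gt0// mulr_gt0.
have [N uN] := ux _ d0; have [N' vN] := vy _ d0.
exists (maxn N N') => n; rewrite geq_max => /andP[/uN un /vN vn].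
have -> : inner (u n) (v n) - inner x y =
    inner (u n) (v n - y) + inner (u n - x) y.
  by rewrite innerBr innerBl addrA subrK.
have d1 : d <= 1 by rewrite ge_min lexx.
have de : d * (2 * M) <= e by rewrite -ler_pdivlMr ?mulr_gt0// ge_min lexx orbT.
have := rnormD (inner (u n) (v n - y)) (inner (u n - x) y).
have := cauchy_schwarz (u n) (v n - y); have := cauchy_schwarz (u n - x) y.
have := rnorm_le_dist (u n) x.
have := rnorm_ge0 (u n); have := rnorm_ge0 (v n - y).
have := rnorm_ge0 (u n - x); have := rnorm_ge0 x; have := rnorm_ge0 y.
move: un vn de d1; rewrite /M.
move: (rnorm (u n)) (rnorm (v n - y)) (rnorm (u n - x)) (rnorm x) (rnorm y) => *.
nra.
Qed.

Lemma dense_approx (D : set E) : closure D = [set: E] ->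
  forall x (e : R), 0 < e -> exists2 y, D y & rnorm (x - y) <= e.
Proof.
move=> DT x e e0; have : closure D x by rewrite DT.
have eC : 0 < e%:C by rewrite ltcR.
move=> /(_ _ (nbhsx_ballx x _ eC))[y [Dy]]; rewrite -ball_normE /= => xy.
by exists y => //; apply: ltW; rewrite -ltcR -normE_rnorm.
Qed.

End HilbertModule.

(** Uniform boundedness, by a gliding hump. If [T] were unbounded, choose [y n]
    with [T y n] much longer than [y n], and build [x] as a series of multiples
    of the [T y n], with signs that keep [inner (T (y n)) x] long; but this is
    [inner (y n) (adjoint T x)], which is at most [rnorm (y n)] times a
    constant. *)
Lemma adjointable_bounded (R : realType) (A : cstarType R)
    (E F : hilbertModType A) (T : 'B*(E, F)) :
  exists C, forall x, rnorm (T x) <= C * rnorm x.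
Proof.
apply: contrapT => unbounded.
have long n : exists y, (2 * n%:R * 3 ^+ n) * rnorm y < rnorm (T y).
  apply: contrapT => /forallNP short; apply: unbounded.
  by exists (2 * n%:R * 3 ^+ n) => x; rewrite leNgt; apply/negP; exact: short.
have /choice[y yT] := long.
have N0 n : 0 < rnorm (T (y n)).
  by apply: le_lt_trans (yT n); rewrite !mulr_ge0 ?exprn_ge0 ?rnorm_ge0.
pose e n : F := ((rnorm (T (y n)))^-1 * 3^-1 ^+ n)%:C *: T (y n).
have e_norm n : rnorm (e n) = 3^-1 ^+ n.
  rewrite rnormZ ger0_norm ?mulr_ge0 ?invr_ge0 ?exprn_ge0 ?rnorm_ge0//.
  by rewrite mulrAC mulVf ?gt_eqF// mul1r.
have hump n (x : F) : exists x', rnorm (x' - x) <= 3^-1 ^+ n /\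
    3^-1 ^+ n * rnorm (T (y n)) <= rnorm (inner (T (y n)) x').
  have inner_e : rnorm (inner (T (y n)) (e n)) = 3^-1 ^+ n * rnorm (T (y n)).
    rewrite innerZr rnormZ -rnorm_inner ger0_norm; last first.
      by rewrite mulr_ge0 ?invr_ge0 ?exprn_ge0 ?rnorm_ge0.
    by rewrite -mulrA mulrCA expr2 mulKf ?gt_eqF.
  have : rnorm (inner (T (y n)) (e n)) + rnorm (inner (T (y n)) (e n))
      <= rnorm (inner (T (y n)) (x + e n)) + rnorm (inner (T (y n)) (x - e n)).
    rewrite innerDr innerBr; set p := inner _ x; set q := inner _ (e n).
    have -> : rnorm q + rnorm q = rnorm ((p + q) - (p - q)).
      rewrite opprB [q - p]addrC addrACA subrr add0r.
      have -> : q + q = 2%:C *: q.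
        by rewrite -[2]/(1 + 1) rmorphD scalerDl !rmorph1 !scale1r.
      by rewrite rnormZ ger0_norm// mulrDl !mul1r.
    exact: rnormB.
  rewrite inner_e => sum_ge.
  have [le|lt] := lerP (3^-1 ^+ n * rnorm (T (y n)))
    (rnorm (inner (T (y n)) (x + e n))).
    by exists (x + e n); rewrite addrC addKr e_norm.
  exists (x - e n); rewrite addrC addKr rnormN e_norm; split=> //.
  by move: sum_ge lt; lra.
have /choice[f fP] : forall nx : nat * F, exists x',
    rnorm (x' - nx.2) <= 3^-1 ^+ nx.1 /\
    3^-1 ^+ nx.1 * rnorm (T (y nx.1)) <= rnorm (inner (T (y nx.1)) x').
  by move=> [n x]; exact: hump.
pose u := fix u n := if n is n'.+1 then f (n', u n') else 0.
(* 3 / 2 * 3 ^- n is the sum of the lengths of the steps from the n-th on, so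
   the steps after the n-th undo at most half of the gain made at it *)
have step n : rnorm (u n.+1 - u n) <=
    - (3 / 2 * 3^-1 ^+ n.+1) - - (3 / 2 * 3^-1 ^+ n).
  have [/= + _] := fP (n, u n); rewrite -/(u n.+1) => /le_trans; apply.
  by rewrite exprS; lra.
have pow0 n : 0 <= 3^-1 ^+ n :> R by rewrite exprn_ge0.
have [x _ xu] : exists2 x, tends u x &
    forall n, rnorm (x - u n) <= 0 - - (3 / 2 * 3^-1 ^+ n).
  apply: dominated_tends step _ => n.
  by rewrite oppr_le0 mulr_ge0.
set B := rnorm (adjoint T x); set n := Num.bound B.
have Bn : B < n%:R by exact/archi_boundP/rnorm_ge0.
have [/= _ + ] := fP (n, u n); rewrite -/(u n.+1) => hump_n.
have := xu n.+1; rewrite sub0r opprK exprS => dist_n.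
have := cauchy_schwarz (y n) (adjoint T x); rewrite -adjointP -/B => small.
have := rnorm_le_dist (inner (T (y n)) (u n.+1)) (inner (T (y n)) x).
rewrite -innerBr => tri; have := cauchy_schwarz (T (y n)) (u n.+1 - x).
rewrite (rnormC (u _)) => cs.
set N := rnorm (T (y n)) in hump_n cs *; set r := 3^-1 ^+ n in hump_n dist_n.
have NrB : N * r <= 2 * (rnorm (y n) * B).
  have : N * rnorm (x - u n.+1) <= N * (3 / 2 * (3^-1 * r)).
    by apply: ler_wpM2l => //; exact: ltW (N0 n).
  by move: hump_n small tri cs; lra.
have rV : 3 ^+ n * r = 1 by rewrite -exprMn mulfV ?expr1n.
have : N <= 2 * 3 ^+ n * (rnorm (y n) * B).
  have := ler_wpM2l (exprn_ge0 n (ler0n R 3)) NrB.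
  by rewrite mulrCA rV mulr1 => /le_trans; apply; rewrite mulrCA !mulrA lexx.
have : 2 * 3 ^+ n * (rnorm (y n) * B) <= 2 * n%:R * 3 ^+ n * rnorm (y n).
  rewrite [leRHS](_ : _ = 2 * 3 ^+ n * (rnorm (y n) * n%:R)); last by ring.
  apply: ler_wpM2l; first by rewrite mulr_ge0 ?exprn_ge0.
  by apply: ler_wpM2l; rewrite ?rnorm_ge0 ?ltW.
by have := yT n; rewrite -/N; lra.
Qed.

(** * Combinations of kernel sections *)

Definition pos_kernel (R : realType) (A : cstarType R) (X : Type)
    (K : X -> X -> A) : Prop :=
  forall n (s : 'I_n -> X) (a : 'I_n -> A),
    positive (\sum_k \sum_l (a k)^† * K (s k) (s l) * a l).

Section Combinations.
Context (R : realType) (A : cstarType R) (X : Type) (K : X -> X -> A).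
Implicit Types (d e : seq (X * A)) (a : A).

(** A list of pairs [(s, a)] stands for the formal combination of the kernel
    sections at [s] with coefficients [a], and [gram] is the inner product of two
    such combinations. Lists make sums concatenations, and they exist before any
    module does: they serve here to compute in a given [rkhm], and further on to
    construct one. *)
Definition gram d e : A := \sum_(p <- d) \sum_(q <- e) p.2^† * K p.1 q.1 * q.2.

Definition comb (E : rkhm K) d : E := \sum_(p <- d) rkhm_fun E p.1 ◁ p.2.

Lemma inner_comb (E : rkhm K) d e : inner (comb E d) (comb E e) = gram d e.
Proof.
rewrite inner_suml; apply: eq_bigr => p _; rewrite inner_sumr.
by apply: eq_bigr => q _; rewrite rkhm_inner.
Qed.

Lemma comb_cat (E : rkhm K) d e : comb E (d ++ e) = comb E d + comb E e.
Proof. by rewrite /comb big_cat. Qed.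

Definition ract d a : seq (X * A) := [seq (p.1, p.2 * a) | p <- d].

Lemma comb_ract (E : rkhm K) d a : comb E (ract d a) = comb E d ◁ a.
Proof.
rewrite act_suml /comb big_map.
by apply: eq_bigr => p _; rewrite actM.
Qed.

Lemma gram_catl d d' e : gram (d ++ d') e = gram d e + gram d' e.
Proof. by rewrite /gram big_cat. Qed.

Lemma gram_catr d e e' : gram d (e ++ e') = gram d e + gram d e'.
Proof.
by rewrite /gram -big_split; apply: eq_bigr => p _; rewrite big_cat.
Qed.

Lemma gram_ractl d e a : gram (ract d a) e = a^† * gram d e.
Proof.
rewrite /gram big_map mulr_sumr; apply: eq_bigr => p _.
by rewrite mulr_sumr; apply: eq_bigr => q _; rewrite starM !mulrA.
Qed.

Lemma gram_ractr d e a : gram d (ract e a) = gram d e * a.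
Proof.
rewrite /gram mulr_suml; apply: eq_bigr => p _.
by rewrite mulr_suml big_map; apply: eq_bigr => q _; rewrite !mulrA.
Qed.

Lemma gram_tnth d : gram d d =
  \sum_i \sum_j (tnth (in_tuple d) i).2^† *
    K (tnth (in_tuple d) i).1 (tnth (in_tuple d) j).1 * (tnth (in_tuple d) j).2.
Proof.
by rewrite /gram big_tnth; apply: eq_bigr => i _; rewrite big_tnth.
Qed.

Lemma comb_dense (E : rkhm K) (x : E) (e : R) : 0 < e ->
  exists d, rnorm (x - comb E d) <= e.
Proof.
move=> e0; have [y [n [c [v [vX ->]]]] xy] := dense_approx (rkhm_dense E) x e0.
have /choice[f fv] : forall i, exists p : X * A, v i = rkhm_fun E p.1 ◁ p.2.
  by move=> i; have [s _ [a _ <-]] := vX i; exists (s, a).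
exists [seq ((f i).1, c i *: (f i).2) | i <- enum 'I_n].
rewrite (_ : comb _ _ = \sum_i c i *: v i)// /comb big_map big_enum /=.
by apply: eq_bigr => i _; rewrite fv actZr.
Qed.

Lemma comb_seq_dense (E : rkhm K) (x : E) :
  exists2 d : nat -> seq (X * A), tends (comb E \o d) x &
    forall n, rnorm (x - comb E (d n)) <= 2^-1 ^+ n.
Proof.
have /choice[d xd] := fun n => comb_dense x (half_pow_gt0 R n).
exists d => // e e0; have [N eN] := half_pow_small e0.
by exists N => n Nn; rewrite rnormC (le_trans (xd n))// eN.
Qed.

Lemma gram_pos d : pos_kernel K -> positive (gram d d).
Proof. by move=> Kpos; rewrite gram_tnth; exact: Kpos. Qed.

End Combinations.

(** * Shift operators *)

Section Shift.
Context (R : realType) (A : cstarType R) (S : starSemigroupType) (w : S -> A).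
Context (E : rkhm (kernel_of w)).
Implicit Types (s t : S) (d e : seq (S * A)) (F G H : E).

Definition translate s d : seq (S * A) := [seq ((s * p.1)%g, p.2) | p <- d].

Lemma translate_cat s d e : translate s (d ++ e) = translate s d ++ translate s e.
Proof. exact: map_cat. Qed.

Lemma gram_translatel s d e :
  gram (kernel_of w) (translate s d) e = gram (kernel_of w) d (translate (s^†)%g e).
Proof.
rewrite /gram big_map; apply: eq_bigr => p _; rewrite big_map.
by apply: eq_bigr => q _; rewrite /kernel_of /= sstarM mulgA.
Qed.

Definition translate_bounded s : Prop := exists2 c : R, 0 <= c &
  forall d, rnorm (comb E (translate s d)) <= c * rnorm (comb E d).

(** The graph of the closure of the operator that shifts combinations by [s]. *)
Definition translate_limit s F G : Prop := exists d : nat -> seq (S * A),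
  tends (comb E \o d) F /\ tends (comb E \o translate s \o d) G.

Lemma translate_limit_comb s d : translate_limit s (comb E d) (comb E (translate s d)).
Proof. by exists (fun=> d); split; exact: tends_cst. Qed.

(** Shifting by [s] and by [s^†] are adjoint on combinations, by
    [gram_translatel], and inner products pass to the limit. This yields the
    adjoint, and the single-valuedness, of the closed operator at once. *)
Lemma translate_limit_adjoint s F G F' G' :
  translate_limit s F G -> translate_limit (s^†)%g F' G' -> inner G F' = inner F G'.
Proof.
move=> [d [dF dG]] [e [eF eG]].
apply: (tends_unique (tends_inner dG eF)).
under eq_fun do rewrite /= inner_comb gram_translatel -(inner_comb E).
exact: tends_inner.
Qed.

Lemma translate_limit_exists s : translate_bounded s ->
  forall F, exists G, translate_limit s F G.
Proof.
move=> [c c0 bound] F; have [d dF dist] := comb_seq_dense F.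
have [G uG _] : exists2 G, tends (comb E \o translate s \o d) G &
    forall n, rnorm (G - comb E (translate s (d n))) <= 0 - - (3 * c * 2^-1 ^+ n).
  apply: dominated_tends => n /=; last first.
    by rewrite oppr_le0 !mulr_ge0// exprn_ge0// invr_ge0.
  have -> : comb E (translate s (d n.+1)) - comb E (translate s (d n)) =
      comb E (translate s (d n.+1 ++ ract (d n) (-1))).
    rewrite translate_cat comb_cat -[X in _ - X]act1 -actNr -comb_ract.
    by rewrite /translate /ract -!map_comp.
  apply: (le_trans (bound _)); rewrite comb_cat comb_ract actNr act1 exprS.
  have near : rnorm (comb E (d n.+1) - comb E (d n)) <= 3 / 2 * 2^-1 ^+ n.
    have := rnorm_triangle F (comb E (d n.+1)) (comb E (d n)).
    have := dist n; have := dist n.+1; rewrite exprS (rnormC F (comb E (d n.+1))).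
    by lra.
  apply: (le_trans (ler_wpM2l c0 near)).
  by rewrite le_eqVlt; apply/orP; left; apply/eqP; field.
by exists G, d.
Qed.

Hypothesis bounded : forall s, translate_bounded s.

Lemma translate_op_exists s : exists T : E -> E, forall F, translate_limit s F (T F).
Proof. by have /choice[T TP] := translate_limit_exists (bounded s); exists T. Qed.

Lemma Phi_exists : exists Phi : S -> 'B*(E, E), forall s, extends_Phi s (Phi s).
Proof.
have /choice[T TP] := translate_op_exists.
have adj s F G : inner (T s F) G = inner F (T (s^†)%g G).
  by apply: translate_limit_adjoint (TP s F) _; exact: TP.
exists (fun s => Adjointable (adj s)) => s n t a /=.
have combE r :
    comb E [seq (r i, a i) | i <- enum 'I_n] = \sum_i rkhm_fun E (r i) ◁ a i.
  by rewrite /comb big_map big_enum.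
rewrite -!combE; apply: inner_ext => G; rewrite adj.
rewrite -(translate_limit_adjoint (translate_limit_comb s _) (TP _ G)).
by rewrite /translate -map_comp.
Qed.

End Shift.

(** * Functions as functionals on combinations *)

Section PreHilbert.
Context (R : realType) (A : cstarType R) (X : Type) (K : X -> X -> A).
Hypothesis Kpos : pos_kernel K.
Implicit Types (d e : seq (X * A)) (u : nat -> seq (X * A)) (a : A).
Implicit Types (G H : X -> A).
Local Notation gram := (gram K).

(** Hermitian symmetry is a consequence of positivity, by polarization: the
    elements [gram d e * c + c^† * gram e d] are selfadjoint for all [c], and
    [c = 1], [c = i] suffice. *)
Lemma gram_star d e : (gram d e)^† = gram e d.
Proof.
have [sd se] : (gram d d)^† = gram d d /\ (gram e e)^† = gram e e.
  by split; apply: (proj1 ((positiveP _).1 _)); exact: gram_pos.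
have sym c : (gram d e * c + c^† * gram e d)^† = gram d e * c + c^† * gram e d.
  have [+ _] := (positiveP _).1 (gram_pos (d ++ ract e c) Kpos).
  rewrite gram_catl !gram_catr !gram_ractr !gram_ractl.
  set x := _ * c; set y := c^† * gram e d; rewrite addrA -[_ + x + y]addrA.
  have se' : (c^† * gram e e * c)^† = c^† * gram e e * c.
    by rewrite !starM starK se mulrA.
  by rewrite starD se' [(gram d d + _)^†]starD sd => /addIr /addrI.
have := sym 1; rewrite star1 mulr1 mul1r; have := sym ('i%C *: (1 : A)).
have -> : ('i%C *: (1 : A))^† = - 'i%C *: (1 : A).
  rewrite starZ star1; congr (_ *: _); apply/eqP.
  by rewrite eq_complex /= oppr0 !eqxx.
rewrite scale_mulr scale_mull mul1r mulr1 scaleNr !starD starN !starZ.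
have -> : 'i^*%C = - 'i%C :> R[i] by apply/eqP; rewrite eq_complex /= oppr0 !eqxx.
set x := gram d e; set y := gram e d => E1 E2.
have {}E1 : x^† - y^† = y - x.
  have := congr1 (fun z => 'i%C *: z) E1; rewrite !scalerDr !scaleNr !scalerN !scalerA.
  by rewrite ['i%C * _]sqr_i !scaleN1r !opprK [RHS]addrC.
have : x^† + x^† = y + y.
  have -> : x^† + x^† = (x^† - y^†) + (x^† + y^†).
    by rewrite addrACA addNr addr0.
  by rewrite E1 E2 subrKA.
move=> /(congr1 (fun z => (2^-1)%:C *: z)).
rewrite !scalerDr -!scalerDl -rmorphD /= (_ : 2^-1 + 2^-1 = 1) ?scale1r//.
by field.
Qed.

Definition seminorm d : R := Num.sqrt (rnorm (gram d d)).

Lemma seminorm_ge0 d : 0 <= seminorm d.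
Proof. exact: sqrtr_ge0. Qed.

Lemma seminorm_sq d : seminorm d ^+ 2 = rnorm (gram d d).
Proof. by rewrite sqr_sqrtr ?rnorm_ge0. Qed.

Lemma gram_le d e : rnorm (gram d e) <= seminorm d * seminorm e.
Proof.
rewrite -ler_sqr ?nnegrE ?mulr_ge0 ?rnorm_ge0 ?seminorm_ge0//.
rewrite exprMn !seminorm_sq; apply: gram_cauchy_schwarz => a b.
have := gram_pos (ract d a ++ ract e b) Kpos.
by rewrite gram_catl !gram_catr !gram_ractl !gram_ractr gram_star !mulrA.
Qed.

Definition formal_diff d e := d ++ ract e (-1).

Lemma gram_diffr d e e' : gram d (formal_diff e e') = gram d e - gram d e'.
Proof. by rewrite gram_catr gram_ractr mulrN1. Qed.

Lemma seminorm_le_diff d e : seminorm d <= seminorm e + seminorm (formal_diff d e).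
Proof.
have := seminorm_ge0 d; rewrite le_eqVlt => /orP[/eqP<-|d0].
  by rewrite addr_ge0// seminorm_ge0.
rewrite -(ler_pM2l d0) -expr2 seminorm_sq mulrDr.
have := gram_le d (formal_diff d e); have := gram_le d e; rewrite gram_diffr.
by have := rnorm_le_dist (gram d d) (gram d e); lra.
Qed.

(** The inner product of the combination [d] with a function [G], in which [G] is
    represented by its values, the inner products of the kernel sections with
    it. *)
Definition pairing d G : A := \sum_(p <- d) p.2^† * G p.1.

Lemma pairing_cat d e G : pairing (d ++ e) G = pairing d G + pairing e G.
Proof. by rewrite /pairing big_cat. Qed.

Lemma pairing_ract d a G : pairing (ract d a) G = a^† * pairing d G.
Proof.
rewrite /pairing big_map mulr_sumr; apply: eq_bigr => p _.
by rewrite starM mulrA.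
Qed.

Lemma pairing_diff d e G : pairing (formal_diff d e) G = pairing d G - pairing e G.
Proof. by rewrite pairing_cat pairing_ract starN star1 mulN1r. Qed.

Lemma pairingD d G H : pairing d (G + H) = pairing d G + pairing d H.
Proof. by rewrite -big_split; apply: eq_bigr => p _; rewrite /= mulrDr. Qed.

Lemma pairingZ d (l : R[i]) G : pairing d (l *: G) = l *: pairing d G.
Proof. by rewrite scaler_sumr; apply: eq_bigr => p _; rewrite scale_mulr. Qed.

Lemma pairingB d G H : pairing d (G - H) = pairing d G - pairing d H.
Proof. by rewrite -scaleN1r pairingD pairingZ scaleN1r. Qed.

Lemma pairing_act d G a : pairing d (fun s => G s * a) = pairing d G * a.
Proof. by rewrite mulr_suml; apply: eq_bigr => p _; rewrite mulrA. Qed.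

Lemma pairing1 s G : pairing [:: (s, 1)] G = G s.
Proof. by rewrite /pairing big_seq1 star1 mul1r. Qed.

Lemma pairing_inj G H : (forall d, pairing d G = pairing d H) -> G = H.
Proof. by move=> GH; apply/funext => s; rewrite -!pairing1. Qed.

Definition evaluation d : X -> A := fun s => \sum_(p <- d) K s p.1 * p.2.

Lemma pairing_evaluation e d : pairing e (evaluation d) = gram e d.
Proof.
apply: eq_bigr => p _; rewrite mulr_sumr; apply: eq_bigr => q _.
by rewrite mulrA.
Qed.

(** The functions [G] act on combinations by [pairing], and are compared in the
    norm of such functionals that is dual to [seminorm]. The completion of the
    space of combinations is the closure, in that norm, of the functionals
    [gram _ d]: its elements are functions on [X] from the outset, and no
    quotient is taken. *)
Definition near_by (eps : R) d G : Prop :=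
  forall e, rnorm (pairing e G - gram e d) <= eps * seminorm e.

Definition in_completion G : Prop := forall eps, 0 < eps -> exists d, near_by eps d G.

Definition approximates (u : nat -> seq (X * A)) G : Prop :=
  forall eps, 0 < eps -> exists N, forall n, (N <= n)%N -> near_by eps (u n) G.

Lemma near_byW eps eps' d G : eps <= eps' -> near_by eps d G -> near_by eps' d G.
Proof.
move=> le dG e; apply: (le_trans (dG e)); exact: ler_wpM2r (seminorm_ge0 e) _ _ le.
Qed.

(** The dual norm of [gram _ d - gram _ d'] is attained at the difference of [d]
    and [d'] itself. *)
Lemma near_by_dist eps eps' d d' G : 0 <= eps -> 0 <= eps' ->
  near_by eps d G -> near_by eps' d' G -> seminorm (formal_diff d d') <= eps + eps'.
Proof.
move=> eps0 eps'0 dG d'G; set e := formal_diff d d'.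
have : seminorm e ^+ 2 <= (eps + eps') * seminorm e.
  rewrite seminorm_sq {2}/e gram_diffr.
  have := rnorm_triangle (pairing e G) (gram e d) (gram e d').
  rewrite (rnormC (gram e d) (pairing e G)); have := dG e; have := d'G e.
  by rewrite mulrDl; lra.
have := seminorm_ge0 e; rewrite le_eqVlt => /orP[/eqP<- _|e0].
  exact: addr_ge0.
by rewrite expr2 ler_pM2r.
Qed.

Lemma near_by_bound eps d G e : near_by eps d G ->
  rnorm (pairing e G) <= (eps + seminorm d) * seminorm e.
Proof.
move=> /(_ e); have := gram_le e d; have := rnorm_le_dist (pairing e G) (gram e d).
by rewrite mulrDl [seminorm d * _]mulrC; lra.
Qed.

Lemma in_completion_bound G : in_completion G ->
  exists2 M, 0 <= M & forall e, rnorm (pairing e G) <= M * seminorm e.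
Proof.
move=> /(_ 1 ltr01)[d dG]; exists (1 + seminorm d).
  by rewrite addr_ge0// seminorm_ge0.
by move=> e; exact: near_by_bound.
Qed.

Lemma near_byD eps eps' d d' G G' : near_by eps d G -> near_by eps' d' G' ->
  near_by (eps + eps') (d ++ d') (G + G').
Proof.
move=> dG dG' e; rewrite pairingD gram_catr opprD addrACA mulrDl.
by apply: (le_trans (rnormD _ _)); exact: lerD.
Qed.

Lemma near_by_act eps d G a : near_by eps d G ->
  near_by (eps * rnorm a) (ract d a) (fun s => G s * a).
Proof.
move=> dG e; rewrite gram_ractr.
rewrite pairing_act -mulrBl; apply: (le_trans (rnormM _ _)).
by rewrite mulrAC; apply: ler_wpM2r; rewrite ?rnorm_ge0.
Qed.

Lemma near_by_evaluation d : near_by 0 d (evaluation d).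
Proof. by move=> e; rewrite pairing_evaluation subrr rnorm0 mul0r. Qed.

Lemma act_scalar G (l : R[i]) : (fun s => G s * (l *: (1 : A))) = l *: G.
Proof. by apply/funext => s; rewrite scale_mulr mulr1. Qed.

Lemma approximates_evaluation d : approximates (fun=> d) (evaluation d).
Proof.
move=> eps e0; exists 0%N => n _; apply: near_byW (ltW e0) _.
exact: near_by_evaluation.
Qed.

Lemma approximatesD u u1 G G' : approximates u G -> approximates u1 G' ->
  approximates (fun n => u n ++ u1 n) (G + G').
Proof.
move=> dG dG' e e0; have e20 : 0 < e / 2 by lra.
have [N dN] := dG _ e20; have [N' dN'] := dG' _ e20.
exists (maxn N N') => n; rewrite geq_max => /andP[/dN ? /dN' ?].
by apply: (@near_byW (e / 2 + e / 2)); [lra|exact: near_byD].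
Qed.

Lemma approximates_act u G a : approximates u G ->
  approximates (fun n => ract (u n) a) (fun s => G s * a).
Proof.
move=> dG e e0; have a0 : 0 < rnorm a + 1 by rewrite ltr_wpDl ?rnorm_ge0.
have [N dN] := dG _ (divr_gt0 e0 a0); exists N => n /dN/near_by_act => /(_ a).
apply: near_byW; rewrite mulrAC ler_pdivrMr// ler_wpM2l ?lerDl//.
exact: ltW.
Qed.

Lemma in_completion_approximates G : in_completion G ->
  exists2 u, approximates u G & forall n, near_by (2^-1 ^+ n) (u n) G.
Proof.
move=> inG; have /choice[u dG] := fun n => inG _ (half_pow_gt0 R n).
exists u => // e e0; have [N eN] := half_pow_small e0.
by exists N => n Nn; apply: near_byW (dG n); exact: eN.
Qed.

Lemma approximates_in G u : approximates u G -> in_completion G.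
Proof. by move=> dG e /dG[N /(_ N (leqnn N))]; exists (u N). Qed.

Definition limit_inner G H : A :=
  xget 0 [set v | exists2 u, approximates u G &
    tends (fun n => pairing (u n) H) v].

(** Any two approximating sequences of [G] come together in [seminorm], on which
    the bounded functional [pairing _ H] is continuous. *)
Lemma limit_inner_pairing u G H : approximates u G -> in_completion H ->
  tends (fun n => pairing (u n) H) (limit_inner G H).
Proof.
move=> dG /in_completion_bound[M M0 HM].
have [u1 u1G near_u1] := in_completion_approximates (approximates_in dG).
have [v vH _] : exists2 v, tends (fun n => pairing (u1 n) H) v &
    forall n, rnorm (v - pairing (u1 n) H) <= 0 - - (3 * M * 2^-1 ^+ n).
  apply: dominated_tends => n; last first.
    by rewrite oppr_le0 !mulr_ge0// ltW ?half_pow_gt0.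
  rewrite -pairing_diff; apply: (le_trans (HM _)).
  have := near_by_dist (ltW (half_pow_gt0 _ _)) (ltW (half_pow_gt0 _ _))
    (near_u1 n.+1) (near_u1 n).
  move=> /(ler_wpM2l M0)/le_trans; apply; rewrite exprS le_eqVlt.
  by apply/orP; left; apply/eqP; field.
have [u2 u2G u2H] : exists2 u, approximates u G &
    tends (fun n => pairing (u n) H) (limit_inner G H).
  apply: (@xgetPex _ 0 [set v | exists2 u, approximates u G &
    tends (fun n => pairing (u n) H) v]).
  by exists v, u1.
have -> : (fun n => pairing (u n) H) =
    fun n => pairing (u2 n) H + pairing (formal_diff (u n) (u2 n)) H.
  by apply/funext => n; rewrite pairing_diff subrKC.
rewrite -[limit_inner G H]addr0; apply: tendsD => // e e0.
have M20 : 0 < 2 * (M + 1) by rewrite mulr_gt0// ltr_wpDl.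
have eM := divr_gt0 e0 M20.
have [N dN] := dG _ eM; have [N' dN'] := u2G _ eM.
exists (maxn N N') => n; rewrite geq_max subr0 => /andP[/dN near_u /dN' near_u2].
apply: (le_trans (HM _)).
have := near_by_dist (ltW eM) (ltW eM) near_u near_u2.
move=> /(ler_wpM2l M0)/le_trans; apply.
have : e / (2 * (M + 1)) * (2 * (M + 1)) = e by rewrite divfK ?gt_eqF.
by move: eM; set q := e / _; lra.
Qed.

Lemma limit_inner_gram u u1 G H : approximates u G -> approximates u1 H ->
  tends (fun n => gram (u n) (u1 n)) (limit_inner G H).
Proof.
move=> dG u1H.
have -> : (fun n => gram (u n) (u1 n)) =
    fun n => pairing (u n) H + (gram (u n) (u1 n) - pairing (u n) H).
  by apply/funext => n; rewrite subrKC.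
rewrite -[limit_inner G H]addr0; apply: tendsD.
  by apply: limit_inner_pairing => //; exact: approximates_in u1H.
have [N0 dN0] := dG 1 ltr01; pose M := seminorm (u N0) + 2.
have M0 : 0 < M by rewrite ltr_wpDl ?seminorm_ge0.
move=> e e0; have [N dN] := u1H _ (divr_gt0 e0 M0).
exists (maxn N N0) => n; rewrite geq_max => /andP[Nn N0n].
rewrite subr0 rnormC; apply: (le_trans (dN n Nn (u n))).
rewrite mulrAC ler_pdivrMr//; apply: ler_wpM2l; rewrite /M; first exact: ltW.
have := near_by_dist ler01 ler01 (dN0 n N0n) (dN0 N0 (leqnn _)).
by have := seminorm_le_diff (u n) (u N0); lra.
Qed.

End PreHilbert.

(** * Construction of the reproducing kernel Hilbert module *)

Section CompletionSpace.
Context (R : realType) (A : cstarType R) (X : Type) (K : X -> X -> A).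
Implicit Types (G H : X -> A).

Definition completion_pred : {pred X -> A} := fun G => `[< in_completion K G >].

Lemma in_completionD G H :
  in_completion K G -> in_completion K H -> in_completion K (G + H).
Proof.
move=> /in_completion_approximates[u uG _] /in_completion_approximates[v vH _].
exact: approximates_in (approximatesD uG vH).
Qed.

Lemma in_completion_act G a :
  in_completion K G -> in_completion K (fun s => G s * a).
Proof.
move=> /in_completion_approximates[u uG _].
exact: approximates_in (approximates_act a uG).
Qed.

Lemma in_completionZ (l : R[i]) G :
  in_completion K G -> in_completion K (l *: G).
Proof. by rewrite -act_scalar; exact: in_completion_act. Qed.

Lemma in_completion_evaluation d : in_completion K (evaluation K d).
Proof. exact: approximates_in (approximates_evaluation K d). Qed.

Fact completion_submod_closed : submod_closed completion_pred.
Proof.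
split=> [|l G H /asboolP inG /asboolP inH]; apply/asboolP.
  have -> : 0 = evaluation K [::] by apply/funext => s; rewrite /evaluation big_nil.
  exact: in_completion_evaluation.
by apply: in_completionD => //; exact: in_completionZ.
Qed.

HB.instance Definition _ :=
  GRing.isSubmodClosed.Build R[i] (X -> A) completion_pred completion_submod_closed.

End CompletionSpace.

(** The parameter [Kpos] is there for the instances below, whose laws hold only
    for positive kernels. *)
Record completion (R : realType) (A : cstarType R) (X : Type) (K : X -> X -> A)
    (Kpos : pos_kernel K) : Type := Completion {
  completion_val :> X -> A;
  completion_valP : completion_val \in completion_pred K
}.

Section CompletionModule.
Context (R : realType) (A : cstarType R) (X : Type) (K : X -> X -> A).
Context (Kpos : pos_kernel K).
Local Notation E := (completion Kpos).

HB.instance Definition _ := [isSub for @completion_val R A X K Kpos].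
HB.instance Definition _ := [Choice of E by <:].
HB.instance Definition _ := [SubChoice_isSubLmodule of E by <:].

Implicit Types (x y z : E) (a b : A) (d e : seq (X * A)).

Lemma in_completion_val x : in_completion K x.
Proof. by case: x => G /= /asboolP. Qed.

Definition mk_completion (G : X -> A) (inG : in_completion K G) : E :=
  Completion Kpos (asboolT inG).

Definition comp_act x a : E :=
  mk_completion (in_completion_act a (in_completion_val x)).

Definition comp_eval d : E := mk_completion (in_completion_evaluation K d).

Definition comp_inner x y : A := limit_inner K x y.

Lemma comp_approximates x : exists u, approximates K u x.
Proof.
by have [u ux _] := in_completion_approximates (in_completion_val x); exists u.
Qed.

Lemma comp_inner_pairing u x y : approximates K u x ->
  tends (fun n => pairing (u n) y) (comp_inner x y).
Proof. by move=> ux; apply: limit_inner_pairing => //; exact: in_completion_val. Qed.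

Lemma comp_innerDr x y z : comp_inner x (y + z) = comp_inner x y + comp_inner x z.
Proof.
have [u ux] := comp_approximates x.
apply: (tends_unique (comp_inner_pairing (y + z) ux)).
under eq_fun do rewrite pairingD.
by apply: tendsD; exact: comp_inner_pairing.
Qed.

Lemma comp_innerZr (l : R[i]) x y : comp_inner x (l *: y) = l *: comp_inner x y.
Proof.
have [u ux] := comp_approximates x.
apply: (tends_unique (comp_inner_pairing (l *: y) ux)).
under eq_fun do rewrite pairingZ.
by apply: tendsZ; exact: comp_inner_pairing.
Qed.

Lemma comp_inner_act x y a : comp_inner x (comp_act y a) = comp_inner x y * a.
Proof.
have [u ux] := comp_approximates x.
apply: (tends_unique (comp_inner_pairing (comp_act y a) ux)).
under eq_fun do rewrite pairing_act.
by apply: tends_mulr; exact: comp_inner_pairing.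
Qed.

Lemma comp_inner_star y x : (comp_inner x y)^† = comp_inner y x.
Proof.
have [u ux] := comp_approximates x; have [v vy] := comp_approximates y.
apply: (tends_unique (tends_star (limit_inner_gram Kpos ux vy))).
under eq_fun do rewrite gram_star//.
exact: limit_inner_gram.
Qed.

Lemma comp_inner_ge0 x : positive (comp_inner x x).
Proof.
have [u ux] := comp_approximates x; apply: positive_closed => e e0.
have [N uN] := limit_inner_gram Kpos ux ux e0.
exists (gram K (u N) (u N)); first exact: gram_pos.
by rewrite rnormC; exact: uN.
Qed.

Lemma comp_inner_eval d x : comp_inner (comp_eval d) x = pairing d x.
Proof.
have ud : approximates K (fun=> d) (comp_eval d) by exact: approximates_evaluation.
by apply: (tends_unique (comp_inner_pairing x ud)); exact: tends_cst.
Qed.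

Lemma comp_innerDl x y z : comp_inner (x + y) z = comp_inner x z + comp_inner y z.
Proof. by rewrite -comp_inner_star comp_innerDr starD !comp_inner_star. Qed.

Lemma comp_inner_actl x y a : comp_inner (comp_act x a) y = a^† * comp_inner x y.
Proof. by rewrite -comp_inner_star comp_inner_act starM comp_inner_star. Qed.

Lemma comp_innerZl (l : R[i]) x y : comp_inner (l *: x) y = l^*%C *: comp_inner x y.
Proof. by rewrite -comp_inner_star comp_innerZr starZ comp_inner_star. Qed.

(** The laws of the norm must be known before the normed module, and hence the
    Hilbert module, can be declared; so the basic consequences of the inner
    product are derived on [comp_inner] and [comp_norm] first. *)
Definition comp_norm x : R := Num.sqrt (rnorm (comp_inner x x)).

Lemma comp_norm_ge0 x : 0 <= comp_norm x.
Proof. exact: sqrtr_ge0. Qed.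

Lemma comp_norm_sq x : comp_norm x ^+ 2 = rnorm (comp_inner x x).
Proof. by rewrite sqr_sqrtr ?rnorm_ge0. Qed.

Lemma comp_cauchy_schwarz x y :
  rnorm (comp_inner x y) <= comp_norm x * comp_norm y.
Proof.
rewrite -ler_sqr ?nnegrE ?mulr_ge0 ?rnorm_ge0 ?comp_norm_ge0//.
rewrite exprMn !comp_norm_sq; apply: gram_cauchy_schwarz => a b.
have := comp_inner_ge0 (comp_act x a + comp_act y b).
rewrite comp_innerDl !comp_innerDr !comp_inner_actl !comp_inner_act.
by rewrite comp_inner_star !mulrA.
Qed.

Lemma comp_normD x y : comp_norm (x + y) <= comp_norm x + comp_norm y.
Proof.
rewrite -ler_sqr ?nnegrE ?addr_ge0 ?comp_norm_ge0//.
rewrite comp_norm_sq comp_innerDl !comp_innerDr.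
have := comp_cauchy_schwarz x y; have := comp_cauchy_schwarz y x.
have := rnormD (comp_inner x x + comp_inner x y) (comp_inner y x + comp_inner y y).
have := rnormD (comp_inner x x) (comp_inner x y).
have := rnormD (comp_inner y x) (comp_inner y y).
by rewrite -!comp_norm_sq sqrrD !expr2 mulr2n; lra.
Qed.

Lemma comp_normZ (l : R[i]) x : comp_norm (l *: x) = complex.Re `|l| * comp_norm x.
Proof.
have l0 : 0 <= complex.Re `|l| by rewrite normc_def /= sqrtr_ge0.
have lJ : complex.Re `|l^*%C| = complex.Re `|l|.
  by case: l {l0} => a b; rewrite !normc_def /= sqrrN.
rewrite /comp_norm comp_innerZl comp_innerZr !rnormZC lJ mulrA -expr2.
by rewrite sqrtrM ?sqr_ge0// sqrtr_sqr ger0_norm.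
Qed.

Lemma comp_norm_eval d : comp_norm (comp_eval d) = seminorm K d.
Proof. by rewrite /comp_norm comp_inner_eval pairing_evaluation. Qed.

Lemma pairing_le_comp d x : rnorm (pairing d x) <= seminorm K d * comp_norm x.
Proof. by rewrite -comp_inner_eval -comp_norm_eval comp_cauchy_schwarz. Qed.

Lemma comp_norm0_eq0 x : comp_norm x = 0 -> x = 0.
Proof.
move=> x0; apply/val_inj/pairing_inj => d.
rewrite [RHS](_ : _ = pairing d (0 *: (0 : X -> A))); last by rewrite scale0r.
rewrite pairingZ scale0r; apply: rnorm0_eq0; apply/eqP.
by rewrite eq_le rnorm_ge0 andbT; have := pairing_le_comp d x; rewrite x0 mulr0.
Qed.

Let normC x : R[i] := (comp_norm x)%:C.

Let normCD x y : normC (x + y) <= normC x + normC y.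
Proof. by rewrite /normC -rmorphD lecR comp_normD. Qed.

Let normCZ (l : R[i]) x : normC (l *: x) = `|l| * normC x.
Proof. by rewrite /normC comp_normZ rmorphM /=; congr (_ * _); rewrite normc_def. Qed.

Let normC0 x : normC x = 0 -> x = 0.
Proof. by move=> /complexI; exact: comp_norm0_eq0. Qed.

HB.instance Definition _ := Lmodule_isNormed.Build R[i] E normCD normCZ normC0.

Lemma comp_normC x y : comp_norm (x - y) = comp_norm (y - x).
Proof. exact: (rnormC (V := E)). Qed.

Lemma tends_pairing (v : nat -> X -> A) G e :
  (forall s, tends (v^~ s) (G s)) -> tends (fun n => pairing e (v n)) (pairing e G).
Proof.
move=> vG; elim: e => [|p e IH].
  by rewrite /pairing big_nil; under eq_fun do rewrite big_nil; exact: tends_cst.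
rewrite /pairing big_cons; under eq_fun do rewrite big_cons.
by apply: tendsD IH; exact: tends_mull.
Qed.

Lemma near_comp_norm eps d x : 0 <= eps -> near_by K eps d x ->
  comp_norm (comp_eval d - x) <= eps.
Proof.
move=> eps0 dx; have [u ux] := comp_approximates x.
have diff_approx : approximates K (fun n => formal_diff d (u n)) (comp_eval d - x).
  have -> : comp_eval d - x = evaluation K d + (fun s => x s * (-1)) :> (X -> A).
    by congr (_ + _); apply/funext => s; rewrite mulrN1.
  by apply: approximatesD; [exact: approximates_evaluation|exact: approximates_act].
apply/ler_addgt0Pr => e e0; have [N uN] := ux _ e0.
rewrite -ler_sqr ?nnegrE ?addr_ge0 ?comp_norm_ge0 ?(ltW e0)// comp_norm_sq.
have := limit_inner_gram Kpos diff_approx diff_approx.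
apply: (tends_rnorm_le_near (N := N)) => n Nn.
rewrite -seminorm_sq ler_sqr ?nnegrE ?addr_ge0 ?seminorm_ge0 ?(ltW e0)//.
exact: near_by_dist (ltW e0) dx (uN n Nn).
Qed.

(** With [pairing_le_comp], this identifies [comp_norm] with the dual norm. *)
Lemma comp_norm_le c x : 0 <= c ->
  (forall e, rnorm (pairing e x) <= c * seminorm K e) -> comp_norm x <= c.
Proof.
move=> c0 xc; set g := comp_norm x.
have g0 : 0 <= g := comp_norm_ge0 x.
have : g ^+ 2 <= c * g.
  apply/ler_addgt0Pr => e e0; have cg0 : 0 < c + g + 1 by rewrite ltr_wpDl ?addr_ge0.
  have eps0 := divr_gt0 e0 cg0; set eps := e / _ in eps0.
  have epsE : eps * (c + g + 1) = e by rewrite divfK ?gt_eqF.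
  have [d dx] := in_completion_val x eps0.
  have := near_comp_norm (ltW eps0) dx; set z := _ - x => zeps.
  have xE : comp_inner x x = pairing d x - comp_inner z x.
    rewrite -comp_inner_eval -[comp_eval d](subrK x) comp_innerDl -/z.
    by rewrite addrC addKr.
  have := rnormB (pairing d x) (comp_inner z x); rewrite -xE -comp_norm_sq -/g.
  have := comp_cauchy_schwarz z x; rewrite -/g.
  have := ler_wpM2r g0 zeps.
  have : seminorm K d <= g + eps.
    rewrite -comp_norm_eval -[comp_eval d](subrK x) -/z.
    by have := comp_normD z x; rewrite -/g; lra.
  by move=> /(ler_wpM2l c0); have := xc d; move: epsE; lra.
have : 0 <= g by []; rewrite le_eqVlt => /orP[/eqP<-//|{}g0].
by rewrite expr2 ler_pM2r.
Qed.

Lemma comp_complete (F : set_system E) : ProperFilter F -> cauchy F -> cvg F.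
Proof.
move=> FF /cauchyP Fc.
have h0 := half_pow_gt0 R.
have hC n : 0 < (2^-1 ^+ n)%:C :> R[i] by rewrite ltcR.
have ballE x (r : R) y : ball x r%:C y -> comp_norm (x - y) <= r.
  by rewrite -ball_normE /= => xy; apply: ltW; rewrite -ltcR.
(* x picks a point within 2 ^- n of most points of the filter; the limit is
   first found pointwise, as a function on X *)
have /choice[x xF] := fun n => Fc _ (hC n).
have step n : comp_norm (x n.+1 - x n) <= 3 / 2 * 2^-1 ^+ n.
  have [y [/ballE y1 /ballE]] := filter_ex (filterI (xF n.+1) (xF n)).
  rewrite comp_normC => y2; have := comp_normD (x n.+1 - y) (y - x n).
  rewrite subrKA => /le_trans; apply; apply: (le_trans (lerD y1 y2)).
  by rewrite exprS le_eqVlt; apply/orP; left; apply/eqP; field.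
have pair_lim e : exists2 l, tends (fun n => pairing e (x n)) l &
    forall n, rnorm (l - pairing e (x n)) <= 0 - - (3 * seminorm K e * 2^-1 ^+ n).
  apply: dominated_tends => n; last first.
    by rewrite oppr_le0 !mulr_ge0 ?seminorm_ge0 ?(ltW (h0 n)).
  rewrite -pairingB; apply: (le_trans (pairing_le_comp e (x n.+1 - x n))).
  apply: (le_trans (ler_wpM2l (seminorm_ge0 K e) (step n))).
  by rewrite exprS le_eqVlt; apply/orP; left; apply/eqP; field.
have /choice[L xL] : forall s, exists l, tends (fun n => x n s) l.
  move=> s; have [l + _] := pair_lim [:: (s, 1)].
  by under eq_fun do rewrite pairing1; exists l.
have L_dist e n :
    rnorm (pairing e L - pairing e (x n)) <= 3 * 2^-1 ^+ n * seminorm K e.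
  have [l xl /(_ n)] := pair_lim e.
  rewrite (tends_unique xl (tends_pairing e xL)) sub0r opprK.
  by rewrite mulrAC.
have inL : in_completion K L.
  move=> eps eps0; have [N epsN] := half_pow_small (divr_gt0 eps0 (ltr0Sn R 5)).
  have [d dx] := in_completion_val (x N) (divr_gt0 eps0 (ltr0Sn R 1)).
  exists d => e; have := L_dist e N; have := dx e.
  have := ler_wpM2r (seminorm_ge0 K e) (epsN N (leqnn N)).
  have := rnorm_triangle (pairing e (x N)) (pairing e L) (gram K e d).
  by lra.
pose l := mk_completion inL.
have l_dist n : comp_norm (l - x n) <= 3 * 2^-1 ^+ n.
  apply: comp_norm_le => [|e]; first by rewrite mulr_ge0 ?(ltW (h0 n)).
  by rewrite (_ : l - x n = L - x n :> (X -> A)) // pairingB; exact: L_dist.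
apply/cvg_ex; exists l; apply/cvg_ballP => e e0.
have [e0' eE] := gt0_complexE e0.
have [N eN] := half_pow_small (divr_gt0 e0' (ltr0Sn R 4)).
apply: filterS (xF N) => y /ballE xy.
rewrite -ball_normE /= normE_rnorm eE ltcR -[rnorm _]/(comp_norm _).
have := comp_normD (l - x N) (x N - y).
rewrite subrKA => /le_lt_trans; apply; apply: (le_lt_trans (lerD (l_dist N) xy)).
by have := eN N (leqnn N); move: e0'; have := h0 N; lra.
Qed.

HB.instance Definition _ := Uniform_isComplete.Build E comp_complete.

Let comp_actDl x y a : comp_act (x + y) a = comp_act x a + comp_act y a.
Proof. by apply/val_inj/funext => s; rewrite /= mulrDl. Qed.

Let comp_actDr x a b : comp_act x (a + b) = comp_act x a + comp_act x b.
Proof. by apply/val_inj/funext => s; rewrite /= mulrDr. Qed.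

Let comp_actM x a b : comp_act x (a * b) = comp_act (comp_act x a) b.
Proof. by apply/val_inj/funext => s; rewrite /= mulrA. Qed.

Let comp_act1 x : comp_act x 1 = x.
Proof. by apply/val_inj/funext => s; rewrite /= mulr1. Qed.

Let comp_actZl (l : R[i]) x a : comp_act (l *: x) a = l *: comp_act x a.
Proof. by apply/val_inj/funext => s; rewrite /= scale_mull. Qed.

Let comp_actZr (l : R[i]) x a : comp_act x (l *: a) = l *: comp_act x a.
Proof. by apply/val_inj/funext => s; rewrite /= scale_mulr. Qed.

Let comp_normE x : `|x| = sqrtC `|comp_inner x x|.
Proof.
rewrite [`|comp_inner x x|]normE_rnorm -comp_norm_sq rmorphXn /= sqrCK//.
by rewrite lecR comp_norm_ge0.
Qed.

HB.instance Definition _ := @isHilbertModule.Build R A E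
  comp_act comp_inner comp_actDl comp_actDr comp_actM comp_act1 comp_actZl comp_actZr
  comp_innerDr comp_innerZr comp_inner_act comp_inner_star comp_inner_ge0
  comp_normE.

Definition kernel_section (s : X) : E := comp_eval [:: (s, 1)].

Lemma comp_eval_sum d : comp_eval d = \sum_(p <- d) kernel_section p.1 ◁ p.2.
Proof.
apply: inner_ext => x; rewrite inner_suml [LHS]comp_inner_eval.
apply: eq_bigr => p _; rewrite inner_actl [inner _ _]comp_inner_eval.
by rewrite pairing1.
Qed.

(** The elements of the completion carry the inner products of the kernel
    sections with them, the evaluations those of the elements with the kernel
    sections: hence the adjoint. *)
Let ev x (s : X) : A := (x s)^†.

Let ev_inj : injective ev.
Proof.
move=> x y xy; apply/val_inj/funext => s.
by have := congr1 (fun f => (f s)^†) xy; rewrite /ev !starK.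
Qed.

Let ev_section s t : ev (kernel_section s) t = K s t.
Proof.
rewrite /ev /= /evaluation big_seq1 mulr1.
have := gram_star Kpos [:: (t, 1)] [:: (s, 1)].
by rewrite /gram !big_seq1 /= star1 !mul1r !mulr1.
Qed.

Let ev_reproducing x s : ev x s = inner x (kernel_section s).
Proof.
by rewrite -inner_star [inner _ _]comp_inner_eval pairing1.
Qed.

Let section_dense : closure
  (lin_span [set kernel_section s ◁ a | s in [set: X] & a in [set: A]]) = [set: E].
Proof.
apply/seteqP; split=> // x _ B /nbhs_ballP[e /= e0 eB].
have [e0' eE] := gt0_complexE e0.
have e20 : 0 < complex.Re e / 2 by rewrite divr_gt0.
have [d dx] := in_completion_val x e20.
exists (comp_eval d); split; last first.
  apply: eB; rewrite -ball_normE /= normE_rnorm eE ltcR rnormC.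
  apply: (le_lt_trans (near_comp_norm (ltW e20) dx)).
  by move: e0'; lra.
exists (size d), (fun=> 1), (fun i => kernel_section (tnth (in_tuple d) i).1
  ◁ (tnth (in_tuple d) i).2); split=> [i|].
  by exists (tnth (in_tuple d) i).1 => //; exists (tnth (in_tuple d) i).2.
by rewrite comp_eval_sum big_tnth; apply: eq_bigr => i _; rewrite scale1r.
Qed.

Definition completion_rkhm : rkhm K :=
  Rkhm ev_inj ev_section ev_reproducing section_dense.

End CompletionModule.

(** * Boundedness and unitization *)

Section Boundedness.
Context (R : realType) (A : cstarType R) (S : starSemigroupType).
Implicit Types (w : S -> A) (s : S).

Lemma bounded_condition_gram w s : bounded_condition w ->
  exists2 c : R, 0 <= c & forall d,
    rnorm (gram (kernel_of w) (translate s d) (translate s d))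
      <= c * rnorm (gram (kernel_of w) d d).
Proof.
move=> /(_ s)[c c0 bound]; have cE := ge0_complexE c0.
exists (complex.Re c) => [|d]; first by rewrite -lecR -cE.
rewrite -lecR rmorphM /= -cE -!normE_rnorm gram_translatel.
rewrite [gram _ d d]gram_tnth; apply: le_trans (bound _ _ _).
rewrite le_eqVlt; apply/orP; left; apply/eqP; congr `|_|.
rewrite /gram big_tnth; apply: eq_bigr => i _; rewrite /translate !big_map big_tnth.
by apply: eq_bigr => j _; rewrite /kernel_of /= !mulgA.
Qed.

Lemma translate_boundedP w (E : rkhm (kernel_of w)) s (c : R) : 0 <= c ->
  (forall d, rnorm (comb E (translate s d)) ^+ 2 <= c * rnorm (comb E d) ^+ 2) ->
  translate_bounded E s.
Proof.
move=> c0 bound; exists (Num.sqrt c); rewrite ?sqrtr_ge0// => d.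
rewrite -ler_sqr ?nnegrE ?mulr_ge0 ?sqrtr_ge0 ?rnorm_ge0//.
by rewrite exprMn sqr_sqrtr.
Qed.

Lemma bounded_condition_translate w (E : rkhm (kernel_of w)) s :
  bounded_condition w -> translate_bounded E s.
Proof.
move=> /bounded_condition_gram => /(_ s)[c c0 bound].
apply: (translate_boundedP c0) => d.
by rewrite !rnorm_inner !inner_comb bound.
Qed.

Lemma extends_Phi1 w (E : rkhm (kernel_of w)) s (T : 'B*(E, E)) t a :
  extends_Phi s T -> T (rkhm_fun E t ◁ a) = rkhm_fun E (s * t)%g ◁ a.
Proof. by move=> /(_ 1%N (fun=> t) (fun=> a)); rewrite !big_ord1. Qed.

Lemma extends_Phi_adjoint w (E : rkhm (kernel_of w)) s (T : 'B*(E, E)) t :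
  extends_Phi s T -> adjoint T (rkhm_fun E t) = rkhm_fun E (s^† * t)%g.
Proof.
move=> Ts; apply/rkhm_ev_inj/funext => r.
rewrite rkhm_ev_fun rkhm_reproducing -inner_star -adjointP.
rewrite -[rkhm_fun E r]act1 (extends_Phi1 _ _ Ts) act1 inner_star.
by rewrite -rkhm_reproducing rkhm_ev_fun /kernel_of sstarM sstarK mulgA.
Qed.

(** Elements are determined by their values, so this determines [T] also
    outside of the span, on which alone [extends_Phi] prescribes it. *)
Lemma rkhm_ev_Phi w (E : rkhm (kernel_of w)) s (T : 'B*(E, E)) (F : E) t :
  extends_Phi s T -> rkhm_ev (T F) t = rkhm_ev F (s^† * t)%g.
Proof.
by move=> Ts; rewrite !rkhm_reproducing adjointP (extends_Phi_adjoint _ Ts).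
Qed.

End Boundedness.

Section UnitizationBoundedness.
Context (R : realType) (A : cstarType R) (S : starSemigroupType).
Context (w : S -> A) (wp : unitization S -> A) (E : rkhm (kernel_of wp)).
Hypothesis wpE : forall s, wp (base_elt s) = w s.

(** Multiplying by an element of [S] brings the unitization back to [S], where the
    boundedness condition applies. *)
Definition absorb (s : S) (x : unitization S) : S :=
  if x is base_elt t then (s * t)%g else s.

Lemma absorbE s x : (base_elt s * x)%g = base_elt (absorb s x).
Proof. by case: x. Qed.

Definition base_seq (d : seq (S * A)) : seq (unitization S * A) :=
  [seq (base_elt p.1, p.2) | p <- d].

Lemma translate_base s d :
  translate (base_elt s) d = base_seq [seq (absorb s p.1, p.2) | p <- d].
Proof.
by rewrite /translate /base_seq -map_comp; apply: eq_map => p /=; rewrite absorbE.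
Qed.

Lemma translate_base_seq s d :
  translate (base_elt s) (base_seq d) = base_seq (translate s d).
Proof. by rewrite /translate /base_seq -!map_comp. Qed.

Lemma gram_base_seq d : gram (kernel_of wp) (base_seq d) (base_seq d) =
  gram (kernel_of w) d d.
Proof.
rewrite /gram big_map; apply: eq_bigr => p _; rewrite big_map.
by apply: eq_bigr => q _; rewrite /kernel_of -wpE.
Qed.

Lemma translate_translate (s t : unitization S) (d : seq (unitization S * A)) :
  translate s (translate t d) = translate (s * t)%g d.
Proof. by rewrite /translate -map_comp; apply: eq_map => p /=; rewrite mulgA. Qed.

(** Let [x] be a combination over the unitization, [h = s^† * s] and [y] the shift
    of [x] by [h]. As [y] is a combination over [S], shifting it by [h] multiplies
    its norm by at most a constant [k], and by Cauchy-Schwarz [rnorm y ^+ 2], the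
    norm of the inner product of [x] with that shift, is at most
    [k * rnorm x * rnorm y]. So [rnorm y] is at most [k * rnorm x], and the squared
    norm of the shift of [x] by [s], which is the norm of [inner x y], is at most
    [k * rnorm x ^+ 2]. *)
Lemma unitization_translate_bounded s : bounded_condition w ->
  translate_bounded E (base_elt s).
Proof.
move=> /bounded_condition_gram => /(_ (s^† * s)%g); set h := (s^† * s)%g.
move=> [c c0 bound].
have hh : ((base_elt h)^†)%g = base_elt h by congr base_elt; rewrite sstarM sstarK.
have inner_translate t d e : inner (comb E (translate t d)) (comb E e) =
    inner (comb E d) (comb E (translate (t^†)%g e)).
  by rewrite !inner_comb gram_translatel.
have step d : rnorm (comb E (translate (base_elt h) (translate (base_elt h) d)))
    <= Num.sqrt c * rnorm (comb E (translate (base_elt h) d)).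
  rewrite -ler_sqr ?nnegrE ?mulr_ge0 ?sqrtr_ge0 ?rnorm_ge0//.
  rewrite exprMn sqr_sqrtr// !rnorm_inner !inner_comb (translate_base h d).
  by rewrite translate_base_seq !gram_base_seq bound.
have le_h d :
    rnorm (comb E (translate (base_elt h) d)) <= Num.sqrt c * rnorm (comb E d).
  have := rnorm_ge0 (comb E (translate (base_elt h) d)).
  rewrite le_eqVlt => /orP[/eqP<-|y0].
    by rewrite mulr_ge0 ?sqrtr_ge0 ?rnorm_ge0.
  rewrite -(ler_pM2r y0) -expr2 rnorm_inner inner_translate hh.
  apply: (le_trans (cauchy_schwarz _ _)); rewrite mulrAC mulrC.
  by apply: ler_wpM2r; rewrite ?rnorm_ge0.
apply: (translate_boundedP (sqrtr_ge0 c)) => d.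
rewrite rnorm_inner inner_translate translate_translate.
rewrite -[(_ * base_elt s)%g]/(base_elt h).
apply: (le_trans (cauchy_schwarz _ _)).
by rewrite expr2 mulrA mulrC; apply: ler_wpM2r; rewrite ?rnorm_ge0.
Qed.

Lemma unitization_Phi_exists : bounded_condition w ->
  exists Phi : S -> 'B*(E, E), forall s, extends_Phi (base_elt s) (Phi s).
Proof.
move=> bw; have [Phi PhiP] : exists Phi : unitization S -> 'B*(E, E),
    forall s, extends_Phi s (Phi s).
  apply: Phi_exists => -[s|h]; first exact: unitization_translate_bounded.
  exists 1 => // d; rewrite mul1r (_ : translate _ d = d)//.
  by rewrite -[RHS]map_id; apply: eq_map => -[[t|h'] a].
by exists (Phi \o @base_elt S) => s; exact: PhiP.
Qed.

End UnitizationBoundedness.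

Lemma unitization_unit (S : starSemigroupType) : exists e : unitization S,
  [/\ (e^†)%g = e, forall x, (e * x)%g = x & forall x, (x * e)%g = x].
Proof.
have [[e eP]|h] := pselect (exists e : S, is_unit e); last first.
  exists (adj_unit h); split=> // -[t|h'] //.
  by congr adj_unit; exact: Prop_irrelevance.
exists (base_elt e); split=> [|[t|h]|[t|h]].
- congr base_elt; have [_ esE] := eP (e^†)%g; have := sstarM (e^†)%g e.
  by rewrite esE !sstarK => {2}->; rewrite esE.
- by congr base_elt; case: (eP t).
- by case: h; exists e.
- by congr base_elt; case: (eP t).
- by case: h; exists e.
Qed.

Section Vector.
Context (R : realType) (A : cstarType R) (E : hilbertModType A).

Lemma act_adjoint (x : E) (a : regular_module A) (y : E) :
  inner (x ◁ a) y = inner a (inner x y : regular_module A).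
Proof. exact: inner_actl. Qed.

Definition act_op (x : E) : 'B*(regular_module A, E) := Adjointable (act_adjoint x).

End Vector.

(** [Phi s] is bounded like every adjointable operator, and the sums in the
    boundedness condition are the squared norms of [Phi s x] and [x]. *)
Lemma represented_bounded (R : realType) (A : cstarType R)
    (S : starSemigroupType) (w : S -> A) (wp : unitization S -> A)
    (E : rkhm (kernel_of wp)) (Phi : S -> 'B*(E, E)) :
  (forall s, wp (base_elt s) = w s) ->
  (forall s, extends_Phi (base_elt s) (Phi s)) -> bounded_condition w.
Proof.
move=> wpE PhiP s; have [C TC] := adjointable_bounded (Phi s).
exists (C ^+ 2)%:C; first by rewrite lecR sqr_ge0.
move=> n t a; pose x := \sum_i rkhm_fun E (base_elt (t i)) ◁ a i.
have innerE (r : 'I_n -> unitization S) :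
    inner (\sum_i rkhm_fun E (r i) ◁ a i) (\sum_i rkhm_fun E (r i) ◁ a i) =
    \sum_i \sum_j (a i)^† * wp ((r i)^† * r j)%g * a j.
  rewrite inner_suml; apply: eq_bigr => i _; rewrite inner_sumr.
  by apply: eq_bigr => j _; rewrite rkhm_inner.
rewrite !normE_rnorm -rmorphM lecR /=.
have -> : \sum_i \sum_j (a i)^† * w ((t i)^† * t j)%g * a j = inner x x.
  by rewrite innerE; apply: eq_bigr => i _; apply: eq_bigr => j _; rewrite -wpE.
have -> : \sum_i \sum_j (a i)^† * w ((t i)^† * s^† * s * t j)%g * a j =
    inner (Phi s x) (Phi s x).
  rewrite PhiP innerE; apply: eq_bigr => i _; apply: eq_bigr => j _.
  by rewrite -wpE; congr (_ * wp (base_elt _) * _); rewrite sstarM !mulgA.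
rewrite -!rnorm_inner -exprMn ler_sqr ?nnegrE ?rnorm_ge0//.
exact: le_trans (rnorm_ge0 _) (TC x).
Qed.

(** * The representation theorem *)

Theorem theorem15 (R : realType) (A : cstarType R) (S : starSemigroupType)
    (w : S -> A) (w_pd : pos_def w) :
  (* part 1 *)
  ((exists (wp : unitization S -> A) (E : rkhm (kernel_of wp))
           (Phi : S -> 'B*(E, E)) (V : 'B*(regular_module A, E)),
      [/\ extension_of w wp,
          forall s, extends_Phi (base_elt s) (Phi s)
        & forall (s : S) (a b : A),
            a^† * w s * b = inner (V a) (Phi s (V b))])
   <-> bounded_condition w /\ extension_property w)
  /\
  (* parts 2 and 3; f is w as an element of E_w *)
  (forall (E : rkhm (kernel_of w)) (f : E),
     bounded_condition w ->
     rkhm_ev f = w ->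
     (forall s, w (s^†)%g = (w s)^†) ->
     exists (Phi : S -> 'B*(E, E)) (V : 'B*(regular_module A, E)),
       (forall s, extends_Phi s (Phi s)) /\
       [/\ forall (s : S) (a b : A),
             a^† * w s * b = inner (V a) (Phi s (V b)),
           forall a : A, V a = f ◁ a,
           forall (s : S) (a : A), adjoint V (rkhm_fun E s ◁ a) = w s * a
         & forall (s : S) (a b : A),
             a^† * w s * b = inner (f ◁ a) (Phi s (f ◁ b))] /\
       closure (lin_span [set Phi s (V a) | s in [set: S] & a in [set: A]])
         = [set: E] /\
       (forall s, lmul (w s) =1 adjoint V \o Phi s \o V)).
Proof.
split.
  split=> [[wp [E [Phi [V [[wp_pd wpE] PhiP _]]]]]|[bw [wp [wp_pd wpE]]]].
    by split; [exact: represented_bounded wpE PhiP|exists wp].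
  have E : rkhm (kernel_of wp) :=
    completion_rkhm (wp_pd : pos_kernel (kernel_of wp)).
  have [Phi PhiP] := unitization_Phi_exists E wpE bw.
  (* the vector is the kernel section at the unit e *)
  have [e [es el er]] := unitization_unit S.
  exists wp, E, Phi, (act_op (rkhm_fun E e)); split=> // s a b.
  by rewrite /= (extends_Phi1 _ _ (PhiP s)) rkhm_inner /kernel_of er es el wpE.
move=> E f bw fw _; have [Phi PhiP] : exists Phi : S -> 'B*(E, E),
    forall s, extends_Phi s (Phi s).
  by apply: Phi_exists => s; exact: bounded_condition_translate.
(* [f] behaves like the kernel section at a unit: Phi s sends it to the section
   at s *)
have Phi_f s b : Phi s (f ◁ b) = rkhm_fun E s ◁ b.
  apply: rkhm_ev_inj; apply/funext => t.
  by rewrite (rkhm_ev_Phi _ _ (PhiP s)) !rkhm_ev_act fw rkhm_ev_fun.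
exists Phi, (act_op f); split=> //; split.
  have repr s a b : a^† * w s * b = inner (f ◁ a) (Phi s (f ◁ b)).
    by rewrite Phi_f inner_actl inner_act -rkhm_reproducing fw mulrA.
  by split=> // s a; rewrite /= inner_act -rkhm_reproducing fw.
split; last first.
  by move=> s a /=; rewrite Phi_f inner_act -rkhm_reproducing fw.
rewrite -(rkhm_dense E); congr (closure (lin_span _)).
apply/seteqP; split=> x [s _ [a _ <-]]; exists s => //; exists a => //.
  by rewrite /= Phi_f.
by rewrite /= Phi_f.
Qed.
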